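(* Let $\Omega$ be a nonempty finite set and let $\mathscr P=\mathscr T(M)/\langle R\rangle$ be a finitely generated binary quadratic operad. Then $$\mathscr{L}ie^{\mathrm{LMT}}_\Omega\bullet\mathscr P\ \cong\ \mathscr P^{\mathrm{LMT}}_\Omega\ \cong\ \mathscr{C}om^{\mathrm{LMT}}_\Omega\circledcirc\mathscr P ,$$ where $\bullet$ denotes the Manin black product and $\circledcirc$ the Manin white product of operads.
   Context: $\mathbf k$ is a field of characteristic zero; operads are symmetric operads of $\mathbf k$-vector spaces, assumed reduced. For an $\mathbb S$-module $M$, the free operad $\mathscr T(M)$ is spanned by decorated planar rooted trees with labelled leaves (modulo the usual identifications from the symmetric group actions). A finitely generated binary quadratic operad is $\mathscr P=\mathscr T(M)/\langle R\rangle$ with $M=M(2)$ finite dimensional and $R\subseteq\mathscr T(M)(3)$, the span of trees with two vertices. $\mathscr{L}ie$ and $\mathscr{C}om$ are the operads of Lie algebras and of commutative (associative) algebras with their standard binary quadratic presentations. Leveled matching operad. For $\omega\in\Omega$ let $M_\omega$ be a copy of $M$, writing $x_\omega$ for the copy of $x\in M$. Write a decorated tree with two vertices as $t(x,y)$ where $x$ decorates the root vertex and $y$ the other vertex. Then $$\mathscr P^{\mathrm{LMT}}_\Omega=\mathscr T\Big(\bigoplus_{\omega\in\Omega}M_\omega\Big)\Big/\Big\langle \sum_i\alpha_i t_i(x^i_\mu,y^i_\nu)\ \Big|\ \sum_i\alpha_it_i(x^i,y^i)\in R,\ \mu,\nu\in\Omega\Big\rangle .$$ Manin products. Let $\mathscr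 P=\mathscr T(M)/\langle R\rangle$, $\mathscr Q=\mathscr T(N)/\langle S\rangle$ be finitely generated binary quadratic. Every element of $\mathscr T(M)(3)$ is a combination of left combs $(\mu_i;\mu_j)_{abc}$ (upper vertex $\mu_i$ with inputs $a,b$; root vertex $\mu_j$ with inputs the upper vertex and $c$) with $(a,b,c)\in\{(1,2,3),(2,3,1),(3,1,2)\}$. White product: $\mathscr P\circledcirc\mathscr Q=\mathscr T(M\otimes N)/\langle\Phi^{-1}(R\otimes\mathscr T(N)(3)+\mathscr T(M)(3)\otimes S)\rangle$, where $\Phi:\mathscr T(M\otimes N)(3)\to\mathscr T(M)(3)\otimes\mathscr T(N)(3)$ sends $(\mu_i\otimes\nu_k;\mu_j\otimes\nu_\ell)_{abc}$ to $(\mu_i;\mu_j)_{abc}\otimes(\nu_k;\nu_\ell)_{abc}$. Black product: $\mathscr P\bullet\mathscr Q=\mathscr T(M\otimes N\otimes\mathrm{sgn}_2)/\langle R\bullet S\rangle$, where $R\bullet S$ is the image of $R\otimes S$ under the map sending $(\mu_i;\mu_j)_{abc}\otimes(\nu_k;\nu_\ell)_{abc}$ to $(\mu_i\otimes\nu_k;\mu_j\otimes\nu_\ell)_{abc}$ and the product of trees with different $(a,b,c)$ to $0$ ($\mathrm{sgn}_2$ is the sign representation of $S_2$). *)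

(* Defs.v *)
From HB Require Import structures.
From mathcomp Require Import all_boot all_fingroup all_algebra.
From mathcomp Require Import boolp.
From mathcomp Require Import freeg zify.

Set Implicit Arguments.
Unset Strict Implicit.
Unset Printing Implicit Defensive.

Import GRing.Theory.
Local Open Scope ring_scope.

Section Submodules.
Variables (K : fieldType) (V : lmodType K).

Record submod := Submod {
  in_submod :> V -> Prop;
  submod0 : in_submod 0;
  submodP : forall a x y, in_submod x -> in_submod y -> in_submod (a *: x + y)
}.

Definition in_span (G : V -> Prop) (x : V) : Prop :=
  forall S : submod, (forall g, G g -> S g) -> S x.

Lemma in_span0 G : in_span G 0.
Proof. by move=> S _; exact: submod0. Qed.

Lemma in_spanP G a x y : in_span G x -> in_span G y -> in_span G (a *: x + y).
Proof. by move=> Gx Gy S GS; apply: submodP; [apply: Gx|apply: Gy]. Qed.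

Definition span (G : V -> Prop) : submod := @Submod (in_span G) (@in_span0 G) (@in_spanP G).

Lemma span_gen (G : V -> Prop) g : G g -> span G g.
Proof. by move=> Gg S GS; exact: GS. Qed.

Variable S : submod.

Lemma submodD x y : S x -> S y -> S (x + y).
Proof. by move=> Sx Sy; rewrite -[x]scale1r; apply: submodP. Qed.
Lemma submodZ a x : S x -> S (a *: x).
Proof. by move=> Sx; rewrite -[_ *: _]addr0; apply: submodP => //; exact: submod0. Qed.
Lemma submodN x : S x -> S (- x).
Proof. by rewrite -scaleN1r; exact: submodZ. Qed.
Lemma submodB x y : S x -> S y -> S (x - y).
Proof. by move=> Sx Sy; apply: submodD => //; exact: submodN. Qed.

(* The quotient V / S: a class is represented by its canonical element. *)
Definition class_rep (x : V) : V := choose (fun y => `[< S (x - y) >]) x.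

Lemma class_repP x : S (x - class_rep x).
Proof.
apply/asboolP; rewrite /class_rep.
by apply: (@chooseP _ (fun y => `[< S (x - y) >])); apply/asboolP; rewrite subrr; exact: submod0.
Qed.

Lemma class_repE x y : S (x - y) -> class_rep x = class_rep y.
Proof.
move=> Sxy; rewrite /class_rep.
have E : (fun z => `[< S (x - z) >]) =1 (fun z => `[< S (y - z) >]).
  move=> z; apply/asboolP/asboolP => h.
    by rewrite (_ : y - z = (x - z) - (x - y)); [apply: submodB|rewrite opprB [RHS]addrC addrA subrK].
  by rewrite (_ : x - z = (x - y) + (y - z)); [apply: submodD|rewrite addrA subrK].
rewrite (eq_choose E); apply: choose_id; apply/asboolP; last by rewrite subrr; exact: submod0.
by rewrite -opprB; exact: submodN.
Qed.

Lemma class_rep_idem x : class_rep (class_rep x) == class_rep x.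
Proof. by apply/eqP/class_repE; rewrite -opprB; apply: submodN; exact: class_repP. Qed.

Record quot := Quot { qrep : V; _ : class_rep qrep == qrep }.

HB.instance Definition _ := [isSub for qrep].
HB.instance Definition _ := [Choice of quot by <:].

Definition qpi (x : V) : quot := Quot (class_rep_idem x).

Lemma qrepK q : qpi (qrep q) = q.
Proof. by apply/val_inj; case: q => x /= /eqP. Qed.

Lemma qpi_eq x y : qpi x = qpi y <-> S (x - y).
Proof.
split=> [/(congr1 qrep) /= E | /class_repE E]; last exact/val_inj.
rewrite (_ : x - y = (x - class_rep x) - (y - class_rep y)).
  by apply: submodB; exact: class_repP.
by rewrite E opprB addrA subrK.
Qed.

Lemma qrep_qpi x : S (qrep (qpi x) - x).
Proof. by apply/qpi_eq; rewrite qrepK. Qed.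

Definition qadd p q := qpi (qrep p + qrep q).
Definition qopp p := qpi (- qrep p).
Definition qscale a p := qpi (a *: qrep p).

Lemma qaddE x y : qadd (qpi x) (qpi y) = qpi (x + y).
Proof. by apply/qpi_eq; rewrite opprD addrACA; apply: submodD; exact: qrep_qpi. Qed.
Lemma qoppE x : qopp (qpi x) = qpi (- x).
Proof. by apply/qpi_eq; rewrite -opprD; apply: submodN; exact: qrep_qpi. Qed.
Lemma qscaleE a x : qscale a (qpi x) = qpi (a *: x).
Proof. by apply/qpi_eq; rewrite -scalerBr; apply: submodZ; exact: qrep_qpi. Qed.

Lemma qaddA : associative qadd.
Proof. by move=> p q r; rewrite -(qrepK p) -(qrepK q) -(qrepK r) !qaddE addrA. Qed.
Lemma qaddC : commutative qadd.
Proof. by move=> p q; rewrite /qadd addrC. Qed.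
Lemma qadd0 : left_id (qpi 0) qadd.
Proof. by move=> p; rewrite -(qrepK p) qaddE add0r. Qed.
Lemma qaddN : left_inverse (qpi 0) qopp qadd.
Proof. by move=> p; rewrite -(qrepK p) qoppE qaddE addNr. Qed.

HB.instance Definition _ := GRing.isZmodule.Build quot qaddA qaddC qadd0 qaddN.

Lemma qscaleA a b p : qscale a (qscale b p) = qscale (a * b) p.
Proof. by rewrite -(qrepK p) !qscaleE scalerA. Qed.
Lemma qscale1 : left_id 1 qscale.
Proof. by move=> p; rewrite -(qrepK p) qscaleE scale1r. Qed.
Lemma qscaleDr : right_distributive qscale +%R.
Proof.
move=> a p q; rewrite -(qrepK p) -(qrepK q) qscaleE.
by rewrite -![_ + _]/(qadd _ _) !(qaddE, qscaleE) scalerDr.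
Qed.
Lemma qscaleDl p : {morph qscale^~ p : a b / a + b}.
Proof.
by move=> a b; rewrite -(qrepK p) !qscaleE -[qpi _ + qpi _]/(qadd _ _) qaddE -scalerDl.
Qed.

HB.instance Definition _ :=
  GRing.Zmodule_isLmodule.Build K quot qscaleA qscale1 qscaleDr qscaleDl.

Lemma qpi_linear : linear qpi.
Proof.
move=> a x y; rewrite -[_ *: qpi x]/(qscale _ _) -[_ + qpi y]/(qadd _ _).
by rewrite qscaleE qaddE.
Qed.

HB.instance Definition _ := GRing.isLinear.Build K V quot _ qpi qpi_linear.

Lemma qpi_eq0 x : qpi x = 0 <-> S x.
Proof. by rewrite -[0]/(qpi 0) qpi_eq subr0. Qed.

End Submodules.

Lemma linear_0 (K : fieldType) (U V : lmodType K) (f : U -> V) : linear f -> f 0 = 0.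
Proof. by move=> lf; move: (lf (-1) 0 0); rewrite scaler0 addr0 scaleN1r addNr. Qed.
Lemma linear_D (K : fieldType) (U V : lmodType K) (f : U -> V) :
  linear f -> {morph f : x y / x + y}.
Proof. by move=> lf x y; rewrite -{1}[x]scale1r lf scale1r. Qed.
Lemma linear_Z (K : fieldType) (U V : lmodType K) (f : U -> V) a x :
  linear f -> f (a *: x) = a *: f x.
Proof. by move=> lf; rewrite -[a *: x]addr0 lf linear_0 // addr0. Qed.

Section FreeModule.
Variables (K : fieldType) (X : choiceType) (V : lmodType K) (f : X -> V).

Lemma fgliftD : {morph fglift f : D E / D + E}.
Proof.
move=> D E; have B := @lift_is_additive K X V f.
have fN E' : fglift f (- E') = - fglift f E'.
  by rewrite -[- E']add0r B -{1}(subrr E') B subrr add0r.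
by rewrite -{1}[E]opprK B fN opprK.
Qed.

Lemma fgliftU x : fglift f << x >> = f x.
Proof. by rewrite liftU scale1r. Qed.

Lemma fglift_sum I (r : seq I) (F : I -> {freeg X / K}) :
  fglift f (\sum_(i <- r) F i) = \sum_(i <- r) fglift f (F i).
Proof.
apply: (big_morph _ fgliftD).
by have := fgliftD 0 0; rewrite addr0 => /eqP; rewrite -subr_eq0 opprD addrA subrr sub0r oppr_eq0 => /eqP.
Qed.

Lemma fgliftZ a D : fglift f (a *: D) = a *: fglift f D.
Proof.
rewrite -[X in _ = _ *: fglift f X]freeg_sumE [a *: D]/(fgscale a D) /fgscale.
by rewrite !fglift_sum scaler_sumr; apply: eq_bigr => x _; rewrite !liftU scalerA.
Qed.

Lemma fglift_linear : linear (fglift f).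
Proof. by move=> a x y; rewrite fgliftD fgliftZ. Qed.

End FreeModule.

Lemma fgZU (K : fieldType) (X : choiceType) (a : K) (x : X) :
  << a *g x >> = a *: << x >> :> {freeg X / K}.
Proof. by apply/eqP/freeg_eqP => y; rewrite coeffZ !coeffU mul1r. Qed.

Section Presented.
Variables (K : fieldType) (X : choiceType) (G : {freeg X / K} -> Prop).

Definition pres : lmodType K := quot (span G).
Definition pgen (x : X) : pres := qpi (span G) << x >>.

Lemma pres_ind (P : pres -> Prop) :
    P 0 -> (forall a x y, P x -> P y -> P (a *: x + y)) -> (forall x, P (pgen x)) ->
  forall x, P x.
Proof.
move=> P0 PD Pg x; rewrite -(qrepK x) -(freeg_sumE (qrep x)).
elim: (dom _) => [|y r IH]; first by rewrite big_nil linear0.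
rewrite big_cons linearD fgZU linearZ; apply: PD => //; exact: Pg.
Qed.

Variables (V : lmodType K) (f : X -> V).

Definition plift (q : pres) : V := fglift f (qrep q).

Hypothesis fG : forall g, G g -> fglift f g = 0.

Lemma fglift_span g : span G g -> fglift f g = 0.
Proof.
pose S := @Submod K _ (fun g => fglift f g = 0) (linear_0 (fglift_linear f))
  (fun a x y (hx : fglift f x = 0) (hy : fglift f y = 0) =>
    etrans (fglift_linear f a x y) (etrans (congr2 (fun u v => a *: u + v) hx hy)
       (etrans (addr0 _) (scaler0 _ _)))).
by move=> Gg; apply: (Gg S).
Qed.

Lemma plift_qpi D : plift (qpi (span G) D) = fglift f D.
Proof.
apply/eqP; rewrite -subr_eq0 -scaleN1r addrC -fglift_linear scaleN1r addrC.
by apply/eqP/fglift_span/qrep_qpi.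
Qed.

Lemma plift_gen x : plift (pgen x) = f x.
Proof. by rewrite plift_qpi fgliftU. Qed.

Lemma plift_linear : linear plift.
Proof.
move=> a x y; rewrite -(qrepK x) -(qrepK y) -linearP !plift_qpi.
exact: fglift_linear.
Qed.

End Presented.

Lemma pres_ext (K : fieldType) (X : choiceType) (G : {freeg X / K} -> Prop)
    (V : lmodType K) (f g : pres G -> V) :
  linear f -> linear g -> (forall x, f (pgen G x) = g (pgen G x)) -> f =1 g.
Proof.
move=> lf lg fg; apply: pres_ind => //; first by rewrite !linear_0.
by move=> a x y Ex Ey; rewrite lf lg Ex Ey.
Qed.

Definition bilinear_map (K : fieldType) (U V W : lmodType K) (f : U -> V -> W) : Prop :=
  (forall v, linear (f^~ v)) /\ (forall u, linear (f u)).

Section Tensor.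
Variables (K : fieldType) (U V : lmodType K).

Inductive tens_relator : {freeg (U * V)%type / K} -> Prop :=
| TensL a u1 u2 v :
    tens_relator (<< (a *: u1 + u2, v) >> - (a *: << (u1, v) >> + << (u2, v) >>))
| TensR a u v1 v2 :
    tens_relator (<< (u, a *: v1 + v2) >> - (a *: << (u, v1) >> + << (u, v2) >>)).

Definition tensor : lmodType K := pres tens_relator.
Definition tens (u : U) (v : V) : tensor := pgen tens_relator (u, v).

Definition tens_lift (W : lmodType K) (f : U -> V -> W) : tensor -> W :=
  plift (fun uv => f uv.1 uv.2).

Lemma tens_bilinear : bilinear_map tens.
Proof.
split=> [v a x y | u a x y]; rewrite /tens /pgen -linearP; apply/qpi_eq;
  apply: span_gen; [exact: TensL | exact: TensR].
Qed.

Lemma tens_compat (W : lmodType K) (f : U -> V -> W) : bilinear_map f ->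
  forall g, tens_relator g -> fglift (fun uv => f uv.1 uv.2) g = 0.
Proof.
have L := fglift_linear (fun uv => f uv.1 uv.2).
case=> fl fr g; case=> [a u1 u2 v|a u v1 v2]; rewrite -scaleN1r addrC L scaleN1r L !fgliftU /=.
  by rewrite (fl v a u1 u2) addNr.
by rewrite (fr u a v1 v2) addNr.
Qed.

Lemma tens_liftE (W : lmodType K) (f : U -> V -> W) : bilinear_map f ->
  forall u v, tens_lift f (tens u v) = f u v.
Proof. by move=> bf u v; rewrite /tens_lift plift_gen //; exact: tens_compat. Qed.

Lemma tens_lift_linear (W : lmodType K) (f : U -> V -> W) :
  bilinear_map f -> linear (tens_lift f).
Proof. by move=> bf; apply: plift_linear; exact: tens_compat. Qed.

Lemma tensor_ext (W : lmodType K) (f g : tensor -> W) :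
  linear f -> linear g -> (forall u v, f (tens u v) = g (tens u v)) -> f =1 g.
Proof. by move=> lf lg fg; apply: pres_ext => // -[u v]; exact: fg. Qed.

End Tensor.

Section TensorMaps.
Variable K : fieldType.

Definition tens_map (U V U' V' : lmodType K) (f : U -> U') (g : V -> V') :
  tensor U V -> tensor U' V' := tens_lift (fun u v => tens (f u) (g v)).

Lemma tens_map_bilinear (U V U' V' : lmodType K) (f : U -> U') (g : V -> V') :
  linear f -> linear g -> bilinear_map (fun u v => tens (f u) (g v)).
Proof.
move=> lf lg; have [tl tr] := tens_bilinear U' V'.
by split=> [v a x y|u a x y] /=; rewrite ?lf ?lg ?tl ?tr.
Qed.

Lemma tens_mapE (U V U' V' : lmodType K) (f : U -> U') (g : V -> V') :
  linear f -> linear g -> forall u v, tens_map f g (tens u v) = tens (f u) (g v).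
Proof. by move=> lf lg u v; rewrite /tens_map tens_liftE //; exact: tens_map_bilinear. Qed.

Lemma tens_map_linear (U V U' V' : lmodType K) (f : U -> U') (g : V -> V') :
  linear f -> linear g -> linear (tens_map f g).
Proof. by move=> lf lg; apply: tens_lift_linear; exact: tens_map_bilinear. Qed.

(* (a (x) b) (x) (c (x) d) |-> (a (x) c) (x) (b (x) d) *)
Definition tens_mid (A B C D : lmodType K) :
    tensor (tensor A B) (tensor C D) -> tensor (tensor A C) (tensor B D) :=
  tens_lift (fun p q =>
    tens_lift (fun a b => tens_lift (fun c d => tens (tens a c) (tens b d)) q) p).

Section Mid.
Variables A B C D : lmodType K.
Let f4 (a : A) (b : B) (c : C) (d : D) := tens (tens a c) (tens b d).

Lemma tens_mid_bil1 a b : bilinear_map (f4 a b).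
Proof.
have [l1 r1] := tens_bilinear (tensor A C) (tensor B D).
have [_ r2] := tens_bilinear A C; have [_ r3] := tens_bilinear B D.
by split=> [d t x y|c t x y]; rewrite /f4 ?r2 ?r3 ?l1 ?r1.
Qed.

Lemma tens_mid_bil2 q : bilinear_map (fun a b => tens_lift (f4 a b) q).
Proof.
have [l1 r1] := tens_bilinear (tensor A C) (tensor B D).
have [l2 _] := tens_bilinear A C; have [l3 _] := tens_bilinear B D.
split=> [b t x y|a t x y]; move: q.
  apply: tensor_ext; first exact/tens_lift_linear/tens_mid_bil1.
    move=> s p q; rewrite !(tens_lift_linear (tens_mid_bil1 _ _)) !scalerDr !scalerA.
    by rewrite [t * s]mulrC addrACA.
  move=> c d; rewrite !(tens_liftE (tens_mid_bil1 _ _)) /f4.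
  by rewrite l2 l1.
apply: tensor_ext; first exact/tens_lift_linear/tens_mid_bil1.
  move=> s p q; rewrite !(tens_lift_linear (tens_mid_bil1 _ _)) !scalerDr !scalerA.
  by rewrite [t * s]mulrC addrACA.
move=> c d; rewrite !(tens_liftE (tens_mid_bil1 _ _)) /f4.
by rewrite l3 r1.
Qed.

Lemma tens_mid_bil3 :
  bilinear_map (fun p q => tens_lift (fun a b => tens_lift (f4 a b) q) p).
Proof.
split=> [q|p t x y]; first exact/tens_lift_linear/tens_mid_bil2.
move: p; apply: tensor_ext; first exact/tens_lift_linear/tens_mid_bil2.
  move=> s p q; rewrite !(tens_lift_linear (tens_mid_bil2 _)) !scalerDr !scalerA.
  by rewrite [t * s]mulrC addrACA.
by move=> a b; rewrite !(tens_liftE (tens_mid_bil2 _)) (tens_lift_linear (tens_mid_bil1 _ _)).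
Qed.

Lemma tens_mid_linear : linear (@tens_mid A B C D).
Proof. exact/tens_lift_linear/tens_mid_bil3. Qed.

Lemma tens_midE a b c d :
  @tens_mid A B C D (tens (tens a b) (tens c d)) = tens (tens a c) (tens b d).
Proof.
rewrite /tens_mid (tens_liftE tens_mid_bil3) (tens_liftE (tens_mid_bil2 _)).
by rewrite (tens_liftE (tens_mid_bil1 _ _)).
Qed.

End Mid.

(* The image of S (x) T in U (x) V. *)
Definition tens_sub (U V : lmodType K) (S : submod U) (T : submod V) : submod (tensor U V) :=
  span (fun w => exists u v, [/\ S u, T v & w = tens u v]).

End TensorMaps.

(* Planar rooted binary trees with vertices decorated by A and leaves labelled by numbers. *)
Inductive tree (A : Type) := Leaf of nat | Node of A & tree A & tree A.
Arguments Leaf {A} _.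

HB.instance Definition _ (A : Type) := gen_eqMixin (tree A).
HB.instance Definition _ (A : Type) := gen_choiceMixin (tree A).

Section Trees.
Variable A : Type.
Implicit Types (t s : tree A).

Fixpoint leaves t : seq nat :=
  match t with Leaf j => [:: j] | Node _ l r => leaves l ++ leaves r end.

Lemma leaves_gt0 t : (0 < size (leaves t))%N.
Proof. by elim: t => //= x l IHl r _; rewrite size_cat addn_gt0 IHl. Qed.

Fixpoint tsubst t (f : nat -> tree A) : tree A :=
  match t with Leaf j => f j | Node x l r => Node x (tsubst l f) (tsubst r f) end.

Definition relabel (f : nat -> nat) t := tsubst t (fun j => Leaf (f j)).

Lemma leaves_tsubst t f : leaves (tsubst t f) = flatten [seq leaves (f j) | j <- leaves t].
Proof.
elim: t => [j|x l IHl r IHr] /=; first by rewrite cats0.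
by rewrite IHl IHr map_cat flatten_cat.
Qed.

Lemma leaves_relabel f t : leaves (relabel f t) = map f (leaves t).
Proof. by rewrite leaves_tsubst; elim: (leaves t) => //= j r ->. Qed.

Lemma tsubst_tsubst t f g : tsubst (tsubst t f) g = tsubst t (fun j => tsubst (f j) g).
Proof. by elim: t => //= x l -> r ->. Qed.

Lemma eq_in_tsubst t f g : {in leaves t, f =1 g} -> tsubst t f = tsubst t g.
Proof.
elim: t => [j|x l IHl r IHr] /= fg; first by apply: fg; rewrite inE.
rewrite IHl ?IHr // => j jin; apply: fg; rewrite mem_cat jin ?orbT //.
Qed.

Lemma tsubst_Leaf t : tsubst t Leaf = t.
Proof. by elim: t => //= x l -> r ->. Qed.

Definition labelled n t := perm_eq (leaves t) (iota 0 n).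

(* The label of the input j of x in the composite of x and y at the input i of x,
   for j different from i and y of arity n.  The input j of y gets the label i + j. *)
Definition shift_out (n i j : nat) := (if j < i then j else (j + n).-1)%N.

Definition graft_at (n i : nat) s (j : nat) : tree A :=
  if j == i then relabel (addn i) s else Leaf (shift_out n i j).

Definition graft n i t s := tsubst t (graft_at n i s).

Definition perm_nat n (s : 'S_n) (j : nat) : nat :=
  if insub j is Some o then val (s o) else j.

Lemma perm_natE n (s : 'S_n) (o : 'I_n) : perm_nat s o = s o.
Proof. by rewrite /perm_nat valK. Qed.

Lemma perm_natM n (s s' : 'S_n) j : perm_nat (s * s')%g j = perm_nat s' (perm_nat s j).
Proof.
rewrite {1 3}/perm_nat; case: insubP => [o _ _|jn]; first by rewrite perm_natE permM.
by rewrite /perm_nat insubN.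
Qed.

Lemma perm_nat1 n j : perm_nat (1%g : 'S_n) j = j.
Proof. by rewrite /perm_nat; case: insubP => //= o _ <-; rewrite perm1. Qed.

Lemma labelled_mem n t j : labelled n t -> (j \in leaves t) = (j < n)%N.
Proof. by move=> /perm_mem ->; rewrite mem_iota. Qed.

Lemma labelled_relabel n (s : 'S_n) t : labelled n t -> labelled n (relabel (perm_nat s) t).
Proof.
rewrite /labelled leaves_relabel => /(perm_map (perm_nat s)) /perm_trans; apply.
rewrite -val_enum_ord -map_comp.
rewrite (eq_map (g := val \o s)) => [|o]; last by rewrite /= perm_natE.
rewrite map_comp; apply: perm_map; apply: uniq_perm; rewrite ?enum_uniq //.
  by rewrite map_inj_uniq ?enum_uniq //; exact: perm_inj.
move=> o; rewrite mem_enum inE; apply/mapP; exists ((s^-1)%g o); rewrite ?mem_enum //.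
by rewrite permKV.
Qed.

Lemma labelled_graft m n p (e : p.+1 = (m + n)%N) i t s : (i < m)%N ->
  labelled m t -> labelled n s -> labelled p (graft n i t s).
Proof.
rewrite /labelled leaves_tsubst => im tm sn.
apply: (perm_trans (perm_flatten (perm_map _ tm))).
have -> : iota 0 m = iota 0 i ++ i :: iota i.+1 (m - i.+1).
  by rewrite -{1}(subnKC im) addSnnS iotaD add0n.
rewrite map_cat flatten_cat /= /graft_at eqxx leaves_relabel.
have -> : iota 0 p = iota 0 i ++ (iota i n ++ iota (i + n) (m - i.+1)).
  rewrite -iotaD -[X in _ ++ iota X _]add0n -iotaD; congr iota; lia.
rewrite perm_sym.
have F (r : seq nat) (g : nat -> nat) : {in r, forall j, graft_at n i s j = Leaf (g j)} ->
  flatten [seq leaves (graft_at n i s j) | j <- r] = map g r.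
  elim: r => //= j r IH H; rewrite H ?inE ?eqxx // IH // => k kr.
  by apply: H; rewrite inE kr orbT.
rewrite -/(graft_at n i s) (F (iota 0 i) id) ?map_id; last first.
  by move=> j; rewrite mem_iota /= add0n /graft_at /shift_out => ji; rewrite ltn_eqF // ji.
rewrite perm_cat2l (F (iota i.+1 _) (fun j => (j + n).-1)); last first.
  move=> j; rewrite mem_iota /graft_at /shift_out => /andP[ij _].
  by rewrite gtn_eqF // ltnNge ltnW.
have -> k : map (fun j => (j + n).-1) (iota i.+1 k) = iota (i + n) k.
  by elim: k (i) => //= k IH a; rewrite IH.
rewrite perm_cat2r perm_sym -[X in iota X n](addn0) iotaDl.
exact: perm_map.
Qed.

End Trees.

(* Symmetric operads in the partial-composition form.  act x s is the right action that turns
   the input j of x into the input s j (note that (s * t) j = t (s j) for permutations), and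
   circ e i x y plugs y into the input i of x; inputs are numbered from 0. *)
Record operad (K : fieldType) := Operad {
  op :> nat -> lmodType K;
  act : forall n, op n -> 'S_n -> op n;
  unit : op 1;
  circ : forall m n p, p.+1 = (m + n)%N -> 'I_m -> op m -> op n -> op p;
  op_reduced : forall x : op 0, x = 0;
  act_linear : forall n (s : 'S_n), linear (fun x => act x s);
  act1 : forall n (x : op n), act x 1%g = x;
  actM : forall n (x : op n) (s t : 'S_n), act x (s * t)%g = act (act x s) t;
  circ_bilinear : forall m n p (e : p.+1 = (m + n)%N) (i : 'I_m), bilinear_map (circ e i);
  circ_unitl : forall n (e : n.+1 = (1 + n)%N) x, circ e ord0 unit x = x;
  circ_unitr : forall n (e : n.+1 = (n + 1)%N) i x, circ e i x unit = x;
  circ_seq : forall l m n p q r (e1 : p.+1 = (l + m)%N) (e2 : r.+1 = (p + n)%N)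
      (e3 : q.+1 = (m + n)%N) (e4 : r.+1 = (l + q)%N)
      (i : 'I_l) (j : 'I_m) (k : 'I_p) x y z, k = (i + j)%N :> nat ->
    circ e2 k (circ e1 i x y) z = circ e4 i x (circ e3 j y z);
  circ_par : forall l m n p q r (e1 : p.+1 = (l + m)%N) (e2 : r.+1 = (p + n)%N)
      (e3 : q.+1 = (l + n)%N) (e4 : r.+1 = (q + m)%N)
      (i k : 'I_l) (k' : 'I_p) (i' : 'I_q) x y z,
    (i < k)%N -> k' = shift_out m i k :> nat -> i' = i :> nat ->
    circ e2 k' (circ e1 i x y) z = circ e4 i' (circ e3 k x z) y;
  circ_act : forall m n p (e : p.+1 = (m + n)%N) (i : 'I_m) x y (s : 'S_m) (t : 'S_n) (u : 'S_p),
    (forall (j : 'I_m) (k : 'I_p), j != i -> k = shift_out n i j :> nat ->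
        u k = shift_out n (s i) (s j) :> nat) ->
    (forall (j : 'I_n) (k : 'I_p), k = (i + j)%N :> nat -> u k = (s i + t j)%N :> nat) ->
    circ e (s i) (act x s) (act y t) = act (circ e i x y) u
}.
Arguments act {K} _ {n} _ _.
Arguments unit {K} _.
Arguments circ {K} _ {m n p} _ _ _ _.
Arguments op_reduced {K} _ _.
Arguments act_linear {K} _ {n} _.
Arguments act1 {K} _ {n} _.
Arguments actM {K} _ {n} _ _ _.
Arguments circ_bilinear {K} _ {m n p} _ _.
Arguments circ_unitl {K} _ {n} _ _.
Arguments circ_unitr {K} _ {n} _ _ _.
Arguments circ_seq {K} _ {l m n p q r} _ _ _ _ {i j k} _ _ _ _.
Arguments circ_par {K} _ {l m n p q r} _ _ _ _ {i k k' i'} _ _ _ _ _ _.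
Arguments circ_act {K} _ {m n p} _ {i} _ _ {s t u} _ _.

Definition operad_iso (K : fieldType) (P Q : operad K) : Prop :=
  exists f : forall n, P n -> Q n,
    [/\ forall n, linear (@f n) /\ bijective (@f n),
        forall n (x : P n) (s : 'S_n), f n (act P x s) = act Q (f n x) s,
        f 1%N (unit P) = unit Q
      & forall m n p (e : p.+1 = (m + n)%N) (i : 'I_m) x y,
          f p (circ P e i x y) = circ Q e i (f m x) (f n y)].

Section Ideals.
Variables (K : fieldType) (P : operad K).

Record operad_ideal := OperadIdeal {
  ideal_comp :> forall n, submod (P n);
  ideal_act : forall n (x : P n) (s : 'S_n), ideal_comp n x -> ideal_comp n (act P x s);
  ideal_circl : forall m n p (e : p.+1 = (m + n)%N) (i : 'I_m) x y,
    ideal_comp m x -> ideal_comp p (circ P e i x y);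
  ideal_circr : forall m n p (e : p.+1 = (m + n)%N) (i : 'I_m) x y,
    ideal_comp n y -> ideal_comp p (circ P e i x y)
}.

Section Generated.
Variables (k : nat) (G : P k -> Prop).

Definition in_ideal_gen n (x : P n) : Prop :=
  forall J : operad_ideal, (forall g, G g -> J k g) -> J n x.

Lemma in_ideal_gen0 n : in_ideal_gen (0 : P n).
Proof. by move=> J _; exact: submod0. Qed.

Lemma in_ideal_genP n a (x y : P n) :
  in_ideal_gen x -> in_ideal_gen y -> in_ideal_gen (a *: x + y).
Proof. by move=> Ix Iy J JG; apply: submodP; [exact: Ix|exact: Iy]. Qed.

Definition ideal_gen : operad_ideal.
Proof.
apply: (@OperadIdeal (fun n => @Submod _ _ (@in_ideal_gen n) (@in_ideal_gen0 n) (@in_ideal_genP n))).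
- by move=> n x s Ix J JG; apply: ideal_act; exact: Ix.
- by move=> m n p e i x y Ix J JG; apply: ideal_circl; exact: Ix.
- by move=> m n p e i x y Iy J JG; apply: ideal_circr; exact: Iy.
Defined.

End Generated.

Variable J : operad_ideal.

Definition qop n : lmodType K := quot (J n).
Definition qact n (x : qop n) (s : 'S_n) : qop n := qpi (J n) (act P (qrep x) s).
Definition qcirc m n p (e : p.+1 = (m + n)%N) (i : 'I_m) (x : qop m) (y : qop n) : qop p :=
  qpi (J p) (circ P e i (qrep x) (qrep y)).

Lemma qactE n (x : P n) s : qact (qpi (J n) x) s = qpi (J n) (act P x s).
Proof.
apply/qpi_eq; have A := act_linear P s.
rewrite -scaleN1r addrC -A; apply: ideal_act; rewrite scaleN1r addrC; exact: qrep_qpi.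
Qed.

Lemma qcircE m n p (e : p.+1 = (m + n)%N) (i : 'I_m) x y :
  qcirc e i (qpi (J m) x) (qpi (J n) y) = qpi (J p) (circ P e i x y).
Proof.
have [Bl Br] := circ_bilinear P e i.
apply/qpi_eq; set x' := qrep _; set y' := qrep _.
rewrite -(subrK (circ P e i x y') (circ P e i x' y')) -addrA; apply: submodD.
  rewrite -scaleN1r addrC -(Bl y' (-1) x x') scaleN1r addrC.
  apply: ideal_circl; exact: qrep_qpi.
rewrite -scaleN1r addrC -(Br x (-1) y y') scaleN1r addrC.
apply: ideal_circr; exact: qrep_qpi.
Qed.

Lemma qop_ind n (Q : qop n -> Prop) : (forall x : P n, Q (qpi (J n) x)) -> forall x, Q x.
Proof. by move=> h x; rewrite -(qrepK x). Qed.

Definition quot_operad : operad K.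
Proof.
apply: (@Operad K qop qact (qpi (J 1) (unit P)) qcirc).
- by elim/qop_ind=> x; rewrite (op_reduced P x) linear0.
- move=> n s a; elim/qop_ind=> x; elim/qop_ind=> y.
  by rewrite -qpi_linear !qactE (act_linear P s) qpi_linear.
- by move=> n; elim/qop_ind=> x; rewrite qactE act1.
- by move=> n; elim/qop_ind=> x s t; rewrite !qactE actM.
- move=> m n p e i; have [Bl Br] := circ_bilinear P e i.
  split; elim/qop_ind=> x a; elim/qop_ind=> y; elim/qop_ind=> z.
    by rewrite -qpi_linear !qcircE (Bl x a y z) qpi_linear.
  by rewrite -qpi_linear !qcircE (Br x a y z) qpi_linear.
- by move=> n e; elim/qop_ind=> x; rewrite qcircE circ_unitl.
- by move=> n e i; elim/qop_ind=> x; rewrite qcircE circ_unitr.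
- move=> l m n p q r e1 e2 e3 e4 i j k; elim/qop_ind=> x; elim/qop_ind=> y; elim/qop_ind=> z kE.
  by rewrite !qcircE (circ_seq P e1 e2 e3 e4 x y z kE).
- move=> l m n p q r e1 e2 e3 e4 i k k' i'.
  elim/qop_ind=> x; elim/qop_ind=> y; elim/qop_ind=> z ik kE iE.
  by rewrite !qcircE (circ_par P e1 e2 e3 e4 x y z ik kE iE).
- move=> m n p e i; elim/qop_ind=> x; elim/qop_ind=> y s t u h1 h2.
  by rewrite [in RHS]qcircE !qactE qcircE (circ_act P e x y h1 h2).
Defined.

End Ideals.

(* An S_2-module, given by the action of the transposition. *)
Record s2mod (K : fieldType) := S2mod {
  s2car :> lmodType K;
  s2flip : s2car -> s2car;
  s2flip_linear : linear s2flip;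
  s2flipK : involutive s2flip
}.

Section FreeOperad.
Variables (K : fieldType) (M : s2mod K).

Inductive tree_lin (a : K) : tree M -> tree M -> tree M -> Prop :=
| LinRoot x y l r : tree_lin a (Node (a *: x + y) l r) (Node x l r) (Node y l r)
| LinLeft x t t1 t2 r :
    tree_lin a t t1 t2 -> tree_lin a (Node x t r) (Node x t1 r) (Node x t2 r)
| LinRight x l t t1 t2 :
    tree_lin a t t1 t2 -> tree_lin a (Node x l t) (Node x l t1) (Node x l t2).

(* s2flip x is x.(12), that is, (s2flip x)(l, r) = x(r, l). *)
Inductive tree_flip : tree M -> tree M -> Prop :=
| FlipRoot x l r : tree_flip (Node (s2flip x) l r) (Node x r l)
| FlipLeft x t t' r : tree_flip t t' -> tree_flip (Node x t r) (Node x t' r)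
| FlipRight x l t t' : tree_flip t t' -> tree_flip (Node x l t) (Node x l t').

Lemma tree_lin_leaves a t t1 t2 :
  tree_lin a t t1 t2 -> leaves t1 = leaves t /\ leaves t2 = leaves t.
Proof. by elim=> //= [x u u1 u2 r _ [-> ->]|x l u u1 u2 _ [-> ->]]. Qed.

Lemma tree_flip_leaves t t' : tree_flip t t' -> perm_eq (leaves t) (leaves t').
Proof.
elim=> [x l r|x u u' r _ h|x l u u' _ h] /=; first by rewrite perm_catC.
  by rewrite perm_cat2r.
by rewrite perm_cat2l.
Qed.

Lemma tree_lin_tsubst a t t1 t2 f :
  tree_lin a t t1 t2 -> tree_lin a (tsubst t f) (tsubst t1 f) (tsubst t2 f).
Proof. by elim=> *; constructor. Qed.

Lemma tree_flip_tsubst t t' f : tree_flip t t' -> tree_flip (tsubst t f) (tsubst t' f).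
Proof. by elim=> *; constructor. Qed.

Lemma tree_lin_tsubstr a t i f f1 f2 : uniq (leaves t) -> i \in leaves t ->
    (forall j, j != i -> f1 j = f j /\ f2 j = f j) -> tree_lin a (f i) (f1 i) (f2 i) ->
  tree_lin a (tsubst t f) (tsubst t f1) (tsubst t f2).
Proof.
move=> + + ff fi; have E u : i \notin leaves u -> tsubst u f1 = tsubst u f /\ tsubst u f2 = tsubst u f.
  move=> iu; split; apply: eq_in_tsubst => j ju;
    by have /ff[] : j != i by apply: contraNneq iu => <-.
elim: t => [j _|x l IHl r IHr] /=; first by rewrite inE => /eqP <-.
rewrite cat_uniq mem_cat => /and3P[ul /hasPn lr ur].
case: (boolP (i \in leaves l)) => [il _|il] /=.
  have [-> ->] : tsubst r f1 = tsubst r f /\ tsubst r f2 = tsubst r f.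
    by apply: E; apply: contraL il => /lr.
  by constructor; exact: IHl.
by have [-> ->] := E _ il => ir; constructor; exact: IHr.
Qed.

Lemma tree_flip_tsubstr t i f f' : i \in leaves t -> uniq (leaves t) ->
    (forall j, j != i -> f' j = f j) -> tree_flip (f i) (f' i) ->
  tree_flip (tsubst t f) (tsubst t f').
Proof.
move=> + + ff fi; have E u : i \notin leaves u -> tsubst u f' = tsubst u f.
  move=> iu; apply: eq_in_tsubst => j ju; apply: ff.
  by apply: contraNneq iu => <-.
elim: t => [j|x l IHl r IHr] /=; first by rewrite inE => /eqP <-.
rewrite cat_uniq mem_cat => il' /and3P[ul /hasPn lr ur]; move: il'.
case: (boolP (i \in leaves l)) => [il _|il] /=.
  rewrite (E r); last by apply: contraL il => /lr.
  by constructor; exact: IHl.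
by rewrite (E l il) => ir; constructor; exact: IHr.
Qed.

Definition ltree n := {t : tree M | labelled n t}.

Inductive tree_relator n : {freeg (ltree n) / K} -> Prop :=
| RelLin a (t t1 t2 : ltree n) : tree_lin a (val t) (val t1) (val t2) ->
    tree_relator (<< t >> - (a *: << t1 >> + << t2 >>))
| RelFlip (t t' : ltree n) : tree_flip (val t) (val t') -> tree_relator (<< t >> - << t' >>).

(* T(M)(n): trees with leaves labelled bijectively by 0, ..., n - 1, multilinear in the
   decorations of the vertices, modulo the flips. *)
Definition top n : lmodType K := pres (@tree_relator n).
Definition tgen n (t : ltree n) : top n := pgen (@tree_relator n) t.
Definition top_lift n (V : lmodType K) (f : ltree n -> V) : top n -> V := plift f.

Definition compatible n (V : lmodType K) (f : ltree n -> V) : Prop :=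
  (forall a (t t1 t2 : ltree n), tree_lin a (val t) (val t1) (val t2) -> f t = a *: f t1 + f t2) /\
  (forall t t' : ltree n, tree_flip (val t) (val t') -> f t = f t').

Lemma compatible_relator n (V : lmodType K) (f : ltree n -> V) :
  compatible f -> forall g, tree_relator g -> fglift f g = 0.
Proof.
have L := fglift_linear f.
case=> fl ff g [a t t1 t2 h|t t' h]; rewrite -scaleN1r addrC L scaleN1r.
  by rewrite L !fgliftU (fl _ _ _ _ h) addNr.
by rewrite !fgliftU (ff _ _ h) addNr.
Qed.

Lemma top_liftE n (V : lmodType K) (f : ltree n -> V) : compatible f ->
  forall t, top_lift f (tgen t) = f t.
Proof. by move=> cf t; rewrite /top_lift plift_gen //; exact: compatible_relator. Qed.

Lemma top_lift_linear n (V : lmodType K) (f : ltree n -> V) :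
  compatible f -> linear (top_lift f).
Proof. by move=> cf; apply: plift_linear; exact: compatible_relator. Qed.

Lemma tgen_compatible n : compatible (@tgen n).
Proof.
split=> [a t t1 t2 h|t t' h]; rewrite /tgen /pgen -?qpi_linear; apply/qpi_eq; apply: span_gen.
  exact: RelLin.
exact: RelFlip.
Qed.

Lemma top_ind n (Q : top n -> Prop) :
    (forall a x y, Q x -> Q y -> Q (a *: x + y)) -> Q 0 -> (forall t, Q (tgen t)) ->
  forall x, Q x.
Proof. by move=> h1 h2 h3; exact: pres_ind. Qed.

Lemma top_ext n (V : lmodType K) (f g : top n -> V) :
  linear f -> linear g -> (forall t, f (tgen t) = g (tgen t)) -> f =1 g.
Proof. by move=> lf lg fg; exact: pres_ext. Qed.

Definition mklt n (t : tree M) (h : labelled n t) : ltree n := exist _ t h.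

Lemma tgen_eq n (t t' : ltree n) : val t = val t' -> tgen t = tgen t'.
Proof. by move/val_inj->. Qed.

Definition lact n (s : 'S_n) (t : ltree n) : ltree n := mklt (labelled_relabel s (valP t)).
Definition tact n (x : top n) (s : 'S_n) : top n := top_lift (fun t => tgen (lact s t)) x.

Lemma lact_compatible n (s : 'S_n) : compatible (fun t => tgen (lact s t)).
Proof.
have [cl cf] := @tgen_compatible n.
split=> [a t t1 t2 h|t t' h]; first by apply: cl; exact: tree_lin_tsubst.
by apply: cf; exact: tree_flip_tsubst.
Qed.

Definition lgraft m n p (e : p.+1 = (m + n)%N) (i : 'I_m) (t : ltree m) (s : ltree n) :
  ltree p := mklt (labelled_graft e (ltn_ord i) (valP t) (valP s)).

Definition tcirc m n p (e : p.+1 = (m + n)%N) (i : 'I_m) (x : top m) (y : top n) : top p :=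
  top_lift (fun t => top_lift (fun s => tgen (lgraft e i t s)) y) x.

Section Circ.
Variables (m n p : nat) (e : p.+1 = (m + n)%N) (i : 'I_m).

Lemma labelled_uniq k (t : tree M) : labelled k t -> uniq (leaves t).
Proof. by move=> /perm_uniq ->; exact: iota_uniq. Qed.

Lemma lgraft_compatr t : compatible (fun s => tgen (lgraft e i t s)).
Proof.
have [cl cf] := @tgen_compatible p; have tu := labelled_uniq (valP t).
have it : val i \in leaves (val t) by rewrite (labelled_mem _ (valP t)) ltn_ord.
split=> [a s s1 s2 h|s s' h].
  apply: cl; apply: (tree_lin_tsubstr tu it) => [j ji|].
    by rewrite /graft_at (negPf ji).
  by rewrite /graft_at eqxx; exact: tree_lin_tsubst.
apply: cf; apply: (tree_flip_tsubstr it tu) => [j ji|].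
  by rewrite /graft_at (negPf ji).
by rewrite /graft_at eqxx; exact: tree_flip_tsubst.
Qed.

Lemma lgraft_compatl y : compatible (fun t => top_lift (fun s => tgen (lgraft e i t s)) y).
Proof.
have [cl cf] := @tgen_compatible p; have L t := top_lift_linear (lgraft_compatr t).
split=> [a t t1 t2 h|t t' h]; move: y; elim/top_ind=> [b x y Hx Hy||s].
- by rewrite !L Hx Hy !scalerDr !scalerA [b * a]mulrC addrACA.
- by rewrite !(linear_0 (L _)) scaler0 addr0.
- rewrite !(top_liftE (lgraft_compatr _)); by apply: cl; exact: tree_lin_tsubst.
- by rewrite !L Hx Hy.
- by rewrite !(linear_0 (L _)).
- rewrite !(top_liftE (lgraft_compatr _)); by apply: cf; exact: tree_flip_tsubst.
Qed.

Lemma tcirc_bilinear : bilinear_map (tcirc e i).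
Proof.
split=> [y|x a y z]; first exact/top_lift_linear/lgraft_compatl.
move: x; apply: top_ext; first exact/top_lift_linear/lgraft_compatl.
  move=> b u v; rewrite /tcirc !(top_lift_linear (lgraft_compatl _)) !scalerDr !scalerA.
  by rewrite [a * b]mulrC addrACA.
move=> t; rewrite /tcirc !(top_liftE (lgraft_compatl _)).
exact/top_lift_linear/lgraft_compatr.
Qed.

Lemma tcircE t s : tcirc e i (tgen t) (tgen s) = tgen (lgraft e i t s).
Proof. by rewrite /tcirc (top_liftE (lgraft_compatl _)) (top_liftE (lgraft_compatr _)). Qed.

End Circ.

Lemma tactE n (s : 'S_n) t : tact (tgen t) s = tgen (lact s t).
Proof. by rewrite /tact (top_liftE (lact_compatible s)). Qed.

Lemma tact_linear n (s : 'S_n) : linear (fun x : top n => tact x s).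
Proof. exact/top_lift_linear/lact_compatible. Qed.

Definition tunit : top 1 := tgen (@mklt 1 (Leaf 0) isT).

Lemma relabel_relabel (f g : nat -> nat) (t : tree M) : relabel g (relabel f t) = relabel (g \o f) t.
Proof. by rewrite /relabel tsubst_tsubst. Qed.

Lemma tsubst_relabel (f : nat -> nat) g (t : tree M) : tsubst (relabel f t) g = tsubst t (g \o f).
Proof. by rewrite /relabel tsubst_tsubst. Qed.

(* The free operad T(M) on M placed in arity 2: all the vertices of its trees are binary. *)
Definition tree_operad : operad K.
Proof.
apply: (@Operad K top tact tunit tcirc).
- elim/top_ind=> [a x y -> ->||[t lt]]; rewrite ?scaler0 ?addr0 //.
  exfalso; have := perm_size lt; case: t {lt} => //= x l r.
  by rewrite size_cat => /eqP; rewrite addn_eq0 eqn0Ngt leaves_gt0.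
- by move=> n s; exact: tact_linear.
- move=> n; apply: top_ext => [||t]; [exact: tact_linear|by []|].
  rewrite tactE; apply: tgen_eq; rewrite /= -[RHS]tsubst_Leaf ?/graft.
  by apply: eq_in_tsubst => j _; rewrite perm_nat1.
- move=> n x s t; move: x; apply: top_ext => [||u]; first exact: tact_linear.
    by move=> a x y; rewrite !tact_linear.
  rewrite !tactE; apply: tgen_eq => /=; rewrite relabel_relabel.
  by apply: eq_in_tsubst => j _; rewrite perm_natM.
- by move=> m n p e i; exact: tcirc_bilinear.
- move=> n e; apply: top_ext => [||t]; [exact: (tcirc_bilinear _ _).2|by []|].
  rewrite tcircE; apply: tgen_eq; rewrite /= /graft /= /graft_at eqxx -[RHS]tsubst_Leaf.
  by apply: eq_in_tsubst.
- move=> n e i; apply: top_ext => [||t]; [exact: (tcirc_bilinear _ _).1|by []|].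
  rewrite tcircE; apply: tgen_eq; rewrite /= -[RHS]tsubst_Leaf ?/graft.
  apply: eq_in_tsubst => j _; rewrite /graft_at /shift_out; case: eqP => [->|_] /=.
    by rewrite /relabel /= addn0.
  by rewrite addn1 if_same.
- move=> l m n p q r e1 e2 e3 e4 i j k x y z kE; move: x.
  apply: top_ext => [||t].
  + by move=> a u v; rewrite (tcirc_bilinear e1 i).1 (tcirc_bilinear e2 k).1.
  + exact: (tcirc_bilinear e4 i).1.
  move: y; apply: top_ext => [||s].
  + by move=> a u v; rewrite (tcirc_bilinear e1 i).2 (tcirc_bilinear e2 k).1.
  + by move=> a u v; rewrite (tcirc_bilinear e3 j).1 (tcirc_bilinear e4 i).2.
  move: z; apply: top_ext => [||u].
  + exact: (tcirc_bilinear e2 k).2.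
  + by move=> a u v; rewrite (tcirc_bilinear e3 j).2 (tcirc_bilinear e4 i).2.
  rewrite !tcircE; apply: tgen_eq => /=; rewrite /graft tsubst_tsubst.
  apply: eq_in_tsubst => a; rewrite (labelled_mem _ (valP t)) => al.
  have im := ltn_ord i; have jm := ltn_ord j.
  rewrite [graft_at m i _ a]/graft_at [graft_at q i _ a]/graft_at.
  case: eqP => [_|/eqP ai]; last first.
    rewrite /= /graft_at /shift_out kE; have [ai'|ai'] := ltnP a i.
      have h : (a < i + j)%N by lia.
      by rewrite (ltn_eqF h) h.
    have ai2 : (i < a)%N by rewrite ltn_neqAle eq_sym ai.
    rewrite gtn_eqF; last by lia.
    rewrite [in LHS]ltnNge (_ : (i + j <= (a + m).-1)%N) /=; last by lia.
    by congr Leaf; lia.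
  rewrite tsubst_relabel /relabel tsubst_tsubst; apply: eq_in_tsubst => b _ /=.
  rewrite /graft_at kE eqn_add2l; case: eqP => [_|bj].
    by rewrite /relabel tsubst_tsubst; apply: eq_in_tsubst => c _ /=; rewrite addnA.
  by rewrite /shift_out ltn_add2l /=; congr Leaf; case: ltnP => // jb; lia.
- move=> l m n p q r e1 e2 e3 e4 i k k' i' x y z ik k'E i'E; move: x.
  apply: top_ext => [||t].
  + by move=> a u v; rewrite (tcirc_bilinear e1 i).1 (tcirc_bilinear e2 k').1.
  + by move=> a u v; rewrite (tcirc_bilinear e3 k).1 (tcirc_bilinear e4 i').1.
  move: y; apply: top_ext => [||s].
  + by move=> a u v; rewrite (tcirc_bilinear e1 i).2 (tcirc_bilinear e2 k').1.
  + exact: (tcirc_bilinear e4 i').2.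
  move: z; apply: top_ext => [||u].
  + exact: (tcirc_bilinear e2 k').2.
  + by move=> a u v; rewrite (tcirc_bilinear e3 k).2 (tcirc_bilinear e4 i').1.
  rewrite !tcircE; apply: tgen_eq => /=; rewrite /graft !tsubst_tsubst.
  apply: eq_in_tsubst => a; rewrite (labelled_mem _ (valP t)) => al.
  have kl := ltn_ord k; rewrite k'E i'E.
  have sE : shift_out m i k = (k + m).-1 by rewrite /shift_out ltnNge ltnW.
  case: (eqVneq a i) => [->|ai].
    rewrite [graft_at m i _ i]/graft_at eqxx.
    rewrite [graft_at n k _ i]/graft_at ltn_eqF //= /shift_out ik /graft_at eqxx.
    rewrite tsubst_relabel; apply: eq_in_tsubst => b.
    rewrite (labelled_mem _ (valP s)) => bm /=.
    rewrite /shift_out ltnNge (ltnW ik) /= ltn_eqF; last by lia.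
    by rewrite (_ : (i + b < (k + m).-1)%N) //; lia.
  rewrite [graft_at m i _ a]/graft_at (negPf ai) /= sE.
  case: (eqVneq a k) => [->|ak].
    rewrite sE [graft_at n k _ k]/graft_at eqxx {1}/graft_at eqxx tsubst_relabel.
    apply: eq_in_tsubst => b _ /=; rewrite /graft_at /shift_out gtn_eqF; last by lia.
    by rewrite ltnNge (_ : (i <= k + b)%N) /=; [congr Leaf|]; lia.
  rewrite [graft_at n k _ a]/graft_at (negPf ak) /= /graft_at /shift_out.
  move/eqP: ai => ai; move/eqP: ak => ak.
  have [ai'|ai'] := ltnP a i.
    have ak' : (a < k)%N by lia.
    rewrite ak' (ltn_eqF ai') ai' ltn_eqF; last by lia.
    by rewrite (_ : (a < (k + m).-1)%N) //; lia.
  have [ak'|ak'] := ltnP a k.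
    rewrite ltn_eqF; last by lia.
    rewrite (_ : ((a + m).-1 < (k + m).-1)%N); last by lia.
    by rewrite gtn_eqF; last lia; rewrite ltnNge ai'.
  rewrite gtn_eqF; last by lia.
  rewrite [in LHS]ltnNge (_ : ((k + m).-1 <= (a + m).-1)%N) /=; last by lia.
  rewrite gtn_eqF; last by lia.
  by rewrite ltnNge (_ : (i <= (a + n).-1)%N) /=; [congr Leaf|]; lia.
- move=> m n p e i x y s t u h1 h2; move: x.
  apply: top_ext => [||tx].
  + by move=> a v w; rewrite tact_linear (tcirc_bilinear e (s i)).1.
  + by move=> a v w; rewrite (tcirc_bilinear e i).1 tact_linear.
  move: y; apply: top_ext => [||ty].
  + by move=> a v w; rewrite tact_linear (tcirc_bilinear e (s i)).2.
  + by move=> a v w; rewrite (tcirc_bilinear e i).2 tact_linear.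
  rewrite !tactE !tcircE tactE; apply: tgen_eq => /=.
  rewrite /graft /relabel !tsubst_tsubst; apply: eq_in_tsubst => a.
  rewrite (labelled_mem _ (valP tx)) => am /=.
  rewrite -[a]/(val (Ordinal am)); set oa := Ordinal am; rewrite perm_natE.
  have im := ltn_ord i; have am' : (a < m)%N by [].
  rewrite /graft_at !val_eqE (inj_eq perm_inj); case: eqVneq => [_|ai].
    rewrite !tsubst_relabel ?/relabel ?tsubst_tsubst; apply: eq_in_tsubst => b.
    rewrite (labelled_mem _ (valP ty)) => bn /=; congr Leaf.
    rewrite -[b]/(val (Ordinal bn)) perm_natE.
    have ibp : (i + b < p)%N by lia.
    by rewrite -(h2 (Ordinal bn) (Ordinal ibp)) // -perm_natE.
  rewrite /=; congr Leaf.
  have sp : (shift_out n i oa < p)%N.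
    rewrite /shift_out; move: ai; rewrite -val_eqE /oa /= => /eqP ai.
    by case: (ltnP a i) => ?; lia.
  by rewrite -(h1 oa (Ordinal sp)) // -perm_natE.
Defined.

End FreeOperad.

(* A presentation T(M)/<R>; qrel is the space R of relators, a subspace of T(M)(3). *)
Record quad_data (K : fieldType) := QuadData {
  qmod : s2mod K;
  qrel : submod (tree_operad qmod 3)
}.

Definition quad_operad (K : fieldType) (P : quad_data K) : operad K :=
  quot_operad (ideal_gen (qrel P)).

Definition finite_dim (K : fieldType) (V : lmodType K) : Prop :=
  exists n (e : 'I_n -> V), forall v, exists c : 'I_n -> K, v = \sum_i c i *: e i.

Definition finitely_generated (K : fieldType) (P : quad_data K) : Prop := finite_dim (qmod P).

Section Combs.
Variables (K : fieldType) (M : s2mod K).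
Implicit Types x y : M.

(* comb c x y is the left comb (x; y)_{c, c+1, c+2}, labels modulo 3: x decorates the upper
   vertex, with inputs c and c + 1, and y decorates the root. *)
Definition comb_tree (c : 'I_3) x y : tree M :=
  Node y (Node x (Leaf c) (Leaf ((c + 1) %% 3))) (Leaf ((c + 2) %% 3)).

Lemma comb_labelled c x y : labelled 3 (comb_tree c x y).
Proof. by case: c => [[|[|[|]]] h]. Qed.

Definition comb (c : 'I_3) x y : tree_operad M 3 := tgen (mklt (comb_labelled c x y)).

Lemma comb_bilinear c : bilinear_map (comb c).
Proof.
have [cl _] := @tgen_compatible K M 3.
by split=> [y a x x'|x a y y']; apply: cl; do ?constructor.
Qed.

Definition comb_lin (c : 'I_3) : tensor M M -> tree_operad M 3 := tens_lift (comb c).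

(* The coordinates of an element of T(M)(3) in the decomposition of T(M)(3) as the direct sum
   over c of the spaces of combs comb_lin c (M (x) M).  A tree whose upper vertex has inputs
   labelled i, j in this order is a left comb if j = i + 1 mod 3; otherwise the upper vertex is
   flipped. *)
Definition upper_coord (c : 'I_3) (i j : nat) x y : tensor M M :=
  if j == ((i + 1) %% 3)%N then if i == c then tens x y else 0
  else if j == c then tens (s2flip x) y else 0.

Definition comb_coord_tree (c : 'I_3) (t : tree M) : tensor M M :=
  match t with
  | Node y (Node x (Leaf i) (Leaf j)) (Leaf _) => upper_coord c i j x y
  | Node y (Leaf _) (Node x (Leaf i) (Leaf j)) => upper_coord c i j x (s2flip y)
  | _ => 0
  end.

Definition comb_coord (c : 'I_3) : tree_operad M 3 -> tensor M M :=
  top_lift (fun t : ltree M 3 => comb_coord_tree c (val t)).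

Lemma upper_coord_bilinear c i j : bilinear_map (upper_coord c i j).
Proof.
have [tl tr] := tens_bilinear M M.
by split=> [y a x x'|x a y y']; rewrite /upper_coord; do 2?case: ifP => _;
  rewrite ?s2flip_linear ?tl ?tr ?scaler0 ?addr0.
Qed.

Lemma comb_coord_compat c : compatible (fun t : ltree M 3 => comb_coord_tree c (val t)).
Proof.
split.
- move=> a [t _] [t1 _] [t2 _] /=; have ul i j := upper_coord_bilinear c i j.
  case=> [x y l r|x u u1 u2 r h|x l u u1 u2 h].
  + case: l => [i|z [i|? ? ?] [j|? ? ?]]; case: r => [k|z' [k|? ? ?] [k'|? ? ?]] //=;
      rewrite ?scaler0 ?addr0 // ?s2flip_linear; by rewrite (ul _ _).2.
  + case: h => [z z' l' r'|z v v1 v2 r' h|z l' v v1 v2 h].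
    * case: l' => [i|? ? ?]; case: r' => [j|? ? ?]; case: r => [k|? ? ?] //=;
        rewrite ?scaler0 ?addr0 //; by rewrite (ul _ _).1.
    * by case: h => *; rewrite /= ?scaler0 ?addr0.
    * by case: h => *; case: l' => * /=; rewrite ?scaler0 ?addr0.
  + case: h => [z z' l' r'|z v v1 v2 r' h|z l' v v1 v2 h].
    * case: l' => [i|? ? ?]; case: r' => [j|? ? ?]; case: l => [k|? [?|? ? ?] [?|? ? ?]] //=;
        rewrite ?scaler0 ?addr0 //; by rewrite (ul _ _).1.
    * by case: h => *; case: l => [?|? [?|? ? ?] [?|? ? ?]] /=; rewrite ?scaler0 ?addr0.
    * by case: h => *; case: l => [?|? [?|? ? ?] [?|? ? ?]]; case: l' => * /=;
        rewrite ?scaler0 ?addr0.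
- move=> [t lt] [t' lt'] /= h.
  have uf i j x y : i != j -> (i < 3)%N -> (j < 3)%N ->
      upper_coord c i j (s2flip x) y = upper_coord c j i x y.
    by rewrite /upper_coord s2flipK; move: i j => [|[|[|i]]] [|[|[|j]]].
  have l3 i : i \in leaves t -> (i < 3)%N by rewrite (labelled_mem _ lt).
  have := labelled_uniq lt; case: h l3 {lt lt'} => [x l r|x u u' r h|x l u u' h].
  + by case: l => [i|z [i|? ? ?] [j|? ? ?]]; case: r => [k|z' [k|? ? ?] [k'|? ? ?]] //=;
      rewrite s2flipK.
  + case: h => [z l' r'|z v v' r' h|z l' v v' h].
    * case: l' => [i|? ? ?]; case: r' => [j|? ? ?]; case: r => [k|? ? ?] //= l3 un.
      by apply: uf; [move: un => /and3P[]; rewrite !inE => /norP[]|apply: l3|apply: l3];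
        rewrite ?inE ?eqxx ?orbT.
    * by case: h.
    * by case: h; case: l'.
  + case: h => [z l' r'|z v v' r' h|z l' v v' h].
    * case: l' => [i|? ? ?]; case: r' => [j|? ? ?];
        case: l => [k|? [?|? ? ?] [?|? ? ?]] //= l3 un.
      by apply: uf; [move: un => /and3P[_]; rewrite !inE|apply: l3|apply: l3];
        rewrite ?inE ?eqxx ?orbT.
    * by move=> _ _; case: h => *; case: l => [?|? [?|? ? ?] [?|? ? ?]].
    * by move=> _ _; case: h => *; case: l => [?|? [?|? ? ?] [?|? ? ?]]; case: l'.
Qed.

Lemma comb_lin_linear c : linear (comb_lin c).
Proof. exact/tens_lift_linear/comb_bilinear. Qed.

Lemma comb_linE c x y : comb_lin c (tens x y) = comb c x y.
Proof. by rewrite /comb_lin (tens_liftE (comb_bilinear c)). Qed.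

Lemma comb_coord_linear c : linear (comb_coord c).
Proof. exact/top_lift_linear/comb_coord_compat. Qed.

Lemma comb_coordE c c' x y : comb_coord c (comb c' x y) = if c' == c then tens x y else 0.
Proof.
rewrite /comb_coord (top_liftE (comb_coord_compat c)) /= /upper_coord.
by rewrite eqxx.
Qed.

(* Together with comb_coordE, T(M)(3) is the direct sum over c of copies of M (x) M. *)
Lemma comb_span z : z = \sum_c comb_lin c (comb_coord c z).
Proof.
move: z; apply: top_ext => [//|a x y|[t lt]].
  rewrite scaler_sumr -big_split /=; apply: eq_bigr => c _.
  by rewrite comb_coord_linear comb_lin_linear.
rewrite (eq_bigr (fun c => comb_lin c (comb_coord_tree c t))); last first.
  by move=> c _; rewrite /comb_coord (top_liftE (comb_coord_compat c)).
have [_ cf] := @tgen_compatible K M 3.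
have uE i j k x y (l : labelled 3 (Node y (Node x (Leaf i) (Leaf j)) (Leaf k))) :
    tgen (mklt l) = \sum_c comb_lin c (upper_coord c i j x y).
{ have := labelled_uniq l; have l3 q := labelled_mem q l.
  have /= i3 := l3 i; have /= j3 := l3 j; have /= k3 := l3 k.
  move: i3 j3 k3; rewrite !inE !eqxx ?orbT /= => /esym + /esym + /esym +.
  rewrite !big_ord_recl big_ord0 /upper_coord /= addr0 {l3}.
  have l0 c := linear_0 (comb_lin_linear c).
  case: i j k l => [|[|[|?]]] [|[|[|?]]] [|[|[|?]]] //= l _ _ _ _;
    rewrite !l0 ?addr0 ?add0r comb_linE;
    first [exact: tgen_eq | apply/esym; apply: cf; apply: FlipLeft; exact: FlipRoot]. }
case: t lt => [?|z [i|x [i|? ? ?] [j|? ? ?]] [k|x' [i'|? ? ?] [j'|? ? ?]]] lt;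
  have /= := perm_size lt; rewrite ?size_cat //=.
- move=> _; have lt' : labelled 3 (Node (s2flip z) (Node x' (Leaf i') (Leaf j')) (Leaf i)).
    by move: lt; rewrite /labelled /= => lt; rewrite (perm_catC [:: i'; j'] [:: i]).
  rewrite -(uE _ _ _ _ _ lt'); apply: cf => /=; rewrite -[X in Node X _ _](s2flipK z).
  exact: FlipRoot.
all: try by move=> h; exfalso; move: h; repeat match goal with |- context [size (leaves ?u)] =>
  move: (leaves_gt0 u); move: (size (leaves u)) => ? end; lia.
by move=> _; exact: uE.
Qed.

End Combs.

Section S2Modules.
Variable K : fieldType.

Lemma id_linear (V : lmodType K) : linear (@id V).
Proof. by []. Qed.

Lemma opp_linear (V : lmodType K) : linear (fun x : V => - x).
Proof. by move=> a x y; rewrite opprD scalerN. Qed.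

Definition s2triv : s2mod K := @S2mod K K^o id (@id_linear K^o) (fun=> erefl).
Definition s2sgn : s2mod K := @S2mod K K^o (fun x => - x) (@opp_linear K^o) (@opprK K^o).

Section TensorFlip.
Variables M N : s2mod K.

Definition tens_flip : tensor M N -> tensor M N := tens_map (@s2flip K M) (@s2flip K N).

Lemma tens_flip_linear : linear tens_flip.
Proof. by apply: tens_map_linear; exact: s2flip_linear. Qed.

Lemma tens_flipE x y : tens_flip (tens x y) = tens (s2flip x) (s2flip y).
Proof. by rewrite /tens_flip tens_mapE //; exact: s2flip_linear. Qed.

Lemma tens_flipK : involutive tens_flip.
Proof.
apply: tensor_ext => [a x y|//|u v]; first by rewrite !tens_flip_linear.
by rewrite !tens_flipE !s2flipK.
Qed.

Definition s2tensor : s2mod K := S2mod tens_flip_linear tens_flipK.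

End TensorFlip.

Section Twist.
Variable M : s2mod K.

Lemma twist_linear : linear (fun x : M => - s2flip x).
Proof. by move=> a x y; rewrite s2flip_linear opprD scalerN. Qed.

Lemma twistK : involutive (fun x : M => - s2flip x).
Proof.
move=> x; have L := @s2flip_linear K M.
by rewrite -[- s2flip x]scaleN1r linear_Z // s2flipK scaleN1r opprK.
Qed.

(* M (x) sgn_2, on the underlying space of M. *)
Definition s2twist : s2mod K := S2mod twist_linear twistK.

End Twist.

Section DirectSum.
Variables (I : finType) (M : s2mod K).

Definition ffun_flip (f : {ffun I -> M}) : {ffun I -> M} := [ffun i => s2flip (f i)].

Lemma ffun_flip_linear : linear ffun_flip.
Proof. by move=> a f g; apply/ffunP => i; rewrite !ffunE s2flip_linear. Qed.

Lemma ffun_flipK : involutive ffun_flip.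
Proof. by move=> f; apply/ffunP => i; rewrite !ffunE s2flipK. Qed.

Definition s2sum : s2mod K := @S2mod K {ffun I -> M} ffun_flip ffun_flip_linear ffun_flipK.

Definition s2inj (i : I) (x : M) : s2sum := [ffun j => if j == i then x else 0].

Lemma s2inj_linear i : linear (s2inj i).
Proof.
by move=> a x y; apply/ffunP => j; rewrite !ffunE; case: eqP => _ //; rewrite scaler0 addr0.
Qed.

Lemma s2inj_flip i x : s2flip (s2inj i x) = s2inj i (s2flip x).
Proof.
apply/ffunP => j; rewrite !ffunE; case: eqP => _ //.
exact/linear_0/s2flip_linear.
Qed.

End DirectSum.

End S2Modules.

Section LMT.
Variables (K : fieldType) (I : finType).

Section Level.
Variables (M : s2mod K) (mu nu : I).

Fixpoint tree_map (A B : Type) (f : A -> B) (t : tree A) : tree B :=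
  match t with Leaf j => Leaf j | Node x l r => Node (f x) (tree_map f l) (tree_map f r) end.

(* t(x, y) |-> t(x_mu, y_nu), where x decorates the root *)
Definition level_tree (t : tree M) : tree (s2sum I M) :=
  match t with
  | Leaf j => Leaf j
  | Node x l r => Node (s2inj mu x) (tree_map (s2inj nu) l) (tree_map (s2inj nu) r)
  end.

Lemma leaves_tree_map (A B : Type) (f : A -> B) t : leaves (tree_map f t) = leaves t.
Proof. by elim: t => //= x l -> r ->. Qed.

Lemma labelled_level n t : labelled n t -> labelled n (level_tree t).
Proof. by case: t => //= x l r; rewrite /labelled /= !leaves_tree_map. Qed.

Definition level n : tree_operad M n -> tree_operad (s2sum I M) n :=
  top_lift (fun t : ltree M n => tgen (mklt (labelled_level (valP t)))).

Lemma tree_map_lin i a (t t1 t2 : tree M) : tree_lin a t t1 t2 ->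
  tree_lin a (tree_map (@s2inj K I M i) t) (tree_map (@s2inj K I M i) t1)
    (tree_map (@s2inj K I M i) t2).
Proof. by elim=> [x y l r|*|*]; rewrite /= ?s2inj_linear; constructor. Qed.

Lemma tree_map_flip i (t t' : tree M) : tree_flip t t' ->
  tree_flip (tree_map (@s2inj K I M i) t) (tree_map (@s2inj K I M i) t').
Proof. by elim=> [x l r|*|*]; rewrite /= -?s2inj_flip; constructor. Qed.

Lemma level_compat n :
  compatible (fun t : ltree M n => tgen (mklt (labelled_level (valP t)))).
Proof.
have [cl cf] := @tgen_compatible K (s2sum I M) n.
split=> [a t t1 t2 h|t t' h]; [apply: cl => /=|apply: cf => /=]; case: h => *;
  rewrite /= ?s2inj_linear -?s2inj_flip; constructor => //;
  by [exact: tree_map_lin | exact: tree_map_flip].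
Qed.

Lemma level_linear n : linear (@level n).
Proof. exact/top_lift_linear/level_compat. Qed.

Lemma levelE n (t : ltree M n) : level (tgen t) = tgen (mklt (labelled_level (valP t))).
Proof. exact: top_liftE (@level_compat n) t. Qed.

End Level.

Definition lmt (P : quad_data K) : quad_data K :=
  @QuadData K (s2sum I (qmod P))
    (span (fun w => exists mu nu r, qrel P r /\ w = level mu nu r)).

End LMT.

Section Manin.
Variable K : fieldType.

Section Maps.
Variables M N : s2mod K.

(* The map of the white product, characterised by PhiE. *)
Definition Phi (z : tree_operad (s2tensor M N) 3) :
    tensor (tree_operad M 3) (tree_operad N 3) :=
  \sum_c tens_map (@comb_lin K M c) (@comb_lin K N c) (tens_mid (comb_coord c z)).

Lemma Phi_linear : linear Phi.
Proof.
move=> a x y; rewrite /Phi scaler_sumr -big_split /=; apply: eq_bigr => c _.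
rewrite comb_coord_linear tens_mid_linear tens_map_linear //; exact: comb_lin_linear.
Qed.

Lemma PhiE c x y x' y' :
  Phi (comb c (tens x x' : s2tensor M N) (tens y y')) = tens (comb c x y) (comb c x' y').
Proof.
rewrite /Phi (bigD1 c) //= big1 => [|d dc].
  rewrite comb_coordE eqxx tens_midE tens_mapE ?comb_linE ?addr0 //; exact: comb_lin_linear.
rewrite comb_coordE eq_sym (negPf dc) (linear_0 (@tens_mid_linear _ _ _ _ _)).
by apply/linear_0/tens_map_linear; exact: comb_lin_linear.
Qed.

Definition black_pair (r : tree_operad M 3) (s : tree_operad N 3) :
    tree_operad (s2twist (s2tensor M N)) 3 :=
  \sum_c @comb_lin K (s2twist (s2tensor M N)) c (tens_mid (tens (comb_coord c r) (comb_coord c s))).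

(* The map of the black product, characterised by black_mapE. *)
Definition black_map : tensor (tree_operad M 3) (tree_operad N 3) ->
    tree_operad (s2twist (s2tensor M N)) 3 := tens_lift black_pair.

Lemma black_pair_bilinear : bilinear_map black_pair.
Proof.
have [tl tr] := tens_bilinear (tensor M M) (tensor N N).
split=> [s a x y|r a x y]; rewrite /black_pair scaler_sumr -big_split /=;
  apply: eq_bigr => c _; rewrite comb_coord_linear ?tl ?tr tens_mid_linear;
  exact: (@comb_lin_linear K (s2twist (s2tensor M N))).
Qed.

Lemma black_map_linear : linear black_map.
Proof. exact/tens_lift_linear/black_pair_bilinear. Qed.

Lemma black_mapE c c' x y x' y' :
  black_map (tens (@comb K M c x y) (@comb K N c' x' y')) =
  if c == c' then @comb K (s2twist (s2tensor M N)) c (tens x x') (tens y y') else 0.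
Proof.
rewrite /black_map (tens_liftE black_pair_bilinear) /black_pair.
have L0 d := linear_0 (@comb_lin_linear K (s2twist (s2tensor M N)) d).
have M0 := linear_0 (@tens_mid_linear K M M N N).
have [tl tr] := tens_bilinear (tensor M M) (tensor N N).
rewrite (bigD1 c) //= big1 => [|d dc].
  rewrite addr0 !comb_coordE eqxx eq_sym; case: eqP => _.
    by rewrite tens_midE (@comb_linE K (s2twist (s2tensor M N))).
  by rewrite (linear_0 (tr _)) M0 L0.
by rewrite !comb_coordE eq_sym (negPf dc) (linear_0 (tl _)) M0 L0.
Qed.

End Maps.

Definition white (P Q : quad_data K) : quad_data K :=
  @QuadData K (s2tensor (qmod P) (qmod Q))
    (span (fun z => exists u v,
      [/\ tens_sub (qrel P) (span (fun=> True)) u, tens_sub (span (fun=> True)) (qrel Q) v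
        & Phi z = u + v])).

Definition black (P Q : quad_data K) : quad_data K :=
  @QuadData K (s2twist (s2tensor (qmod P) (qmod Q)))
    (span (fun z => exists2 w, tens_sub (qrel P) (qrel Q) w & z = black_map w)).

End Manin.

Section LieCom.
Variable K : fieldType.

(* Jacobi: [[a,b],c] + [[b,c],a] + [[c,a],b] = 0 for an antisymmetric bracket. *)
Definition Lie : quad_data K :=
  @QuadData K (s2sgn K) (span (fun z => z = \sum_c @comb K (s2sgn K) c 1 1)).

(* Associativity: (ab)c = (bc)a = (ca)b for a symmetric product. *)
Definition Com : quad_data K :=
  @QuadData K (s2triv K) (span (fun z =>
    exists c c', z = @comb K (s2triv K) c 1 1 - @comb K (s2triv K) c' 1 1)).

End LieCom.

(* Main.v *)
(* The evident isomorphism K^Omega (x) M -> M^Omega is equivariant for both products: the sign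
   twist of the black product cancels the antisymmetry of Lie.  It remains to compare relators.
   The Jacobi relator at levels (mu, nu) is the sum of the three combs, so its black product
   with a relator v of P is exactly v at levels (mu, nu).  For the white product, the relators of
   Com^LMT are the kernel of the coordinates "coefficient of the levels (mu, nu)", summed over
   the three combs; contracting Phi z with these coordinates recovers the components of z, which
   are therefore relators of P exactly when Phi z lies in the defining subspace. *)
Require Import Defs.
From mathcomp Require Import all_boot all_fingroup all_algebra.
Set Implicit Arguments.
Unset Strict Implicit.
Unset Printing Implicit Defensive.

Import GRing.Theory.
Local Open Scope ring_scope.

(** * Linear maps, spans and preimages of subspaces *)

Section LinearMaps.
Variable K : fieldType.
Implicit Types U V W : lmodType K.

Lemma linear_map_sum U V (f : U -> V) I (r : seq I) (P : pred I) (F : I -> U) :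
  linear f -> f (\sum_(i <- r | P i) F i) = \sum_(i <- r | P i) f (F i).
Proof. by move=> lf; apply: big_morph; [exact: linear_D | exact: linear_0]. Qed.

Lemma linear_map_sub U V (f : U -> V) x y : linear f -> f (x - y) = f x - f y.
Proof. by move=> lf; rewrite -scaleN1r addrC lf scaleN1r addrC. Qed.

Lemma linear_comp U V W (f : V -> W) (g : U -> V) :
  linear f -> linear g -> linear (fun x => f (g x)).
Proof. by move=> lf lg a x y; rewrite lg lf. Qed.

Lemma linear_bigsum U V (I : finType) (F : I -> U -> V) :
  (forall i, linear (F i)) -> linear (fun x => \sum_i F i x).
Proof.
move=> lF a x y; rewrite scaler_sumr -big_split /=.
by apply: eq_bigr => i _; exact: lF.
Qed.

Lemma linear_cancel U V (f : U -> V) (g : V -> U) :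
  linear f -> cancel f g -> cancel g f -> linear g.
Proof. by move=> lf fK gK a x y; rewrite -{1}(gK x) -{1}(gK y) -lf fK. Qed.

Definition preim_submod U V (f : U -> V) (lf : linear f) (S : submod V) : submod U.
Proof.
apply: (@Submod K U (fun x => S (f x))); first by rewrite linear_0 //; exact: submod0.
by move=> a x y Sx Sy; rewrite lf; exact: submodP.
Defined.

(** A span lies in every subspace containing its generators, here in the preimage of [S]. This
    reduces each comparison of relators below to generators. *)
Lemma span_preim U V (f : U -> V) (G : U -> Prop) (S : submod V) : linear f ->
  (forall g, G g -> S (f g)) -> forall x, Defs.span G x -> S (f x).
Proof. by move=> lf GS x /(_ (preim_submod lf S)); exact. Qed.

Lemma submod_sum V (S : submod V) I (r : seq I) (F : I -> V) :
  (forall i, S (F i)) -> S (\sum_(i <- r) F i).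
Proof. by move=> SF; elim/big_rec: _ => [|i x _ Sx]; [exact: submod0 | exact: submodD]. Qed.

End LinearMaps.

(** * Functoriality of the free operad *)

Section FreeOperadMap.
Variables (K : fieldType) (M N : s2mod K) (f : M -> N).
Hypotheses (f_linear : linear f) (f_flip : forall x, f (s2flip x) = s2flip (f x)).

Lemma tree_map_tsubst (A B : Type) (h : A -> B) (t : tree A) (s : nat -> tree A) :
  tree_map h (tsubst t s) = tsubst (tree_map h t) (fun j => tree_map h (s j)).
Proof. by elim: t => //= x l -> r ->. Qed.

Lemma labelled_tree_map n (t : tree M) : labelled n t -> labelled n (tree_map f t).
Proof. by rewrite /labelled leaves_tree_map. Qed.

Definition top_map n : tree_operad M n -> tree_operad N n :=
  top_lift (fun t : ltree M n => tgen (mklt (labelled_tree_map (valP t)))).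

Lemma top_map_compat n :
  compatible (fun t : ltree M n => tgen (mklt (labelled_tree_map (valP t)))).
Proof.
have [cl cf] := @tgen_compatible K N n.
split=> [a t t1 t2 h|t t' h]; [apply: cl => /=|apply: cf => /=].
  by elim: h => *; rewrite /= ?f_linear; constructor.
by elim: h => *; rewrite /= ?f_flip; constructor.
Qed.

Lemma top_map_linear n : linear (@top_map n).
Proof. exact/top_lift_linear/top_map_compat. Qed.

Lemma top_mapE n (t : ltree M n) :
  top_map (tgen t) = tgen (mklt (labelled_tree_map (valP t))).
Proof. exact: top_liftE (@top_map_compat n) t. Qed.

Lemma top_map_comb c x y : top_map (comb c x y) = comb c (f x) (f y).
Proof. by rewrite /comb top_mapE; exact: tgen_eq. Qed.

Lemma top_map_act n (x : tree_operad M n) (s : 'S_n) :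
  top_map (Defs.act _ x s) = Defs.act _ (top_map x) s.
Proof.
move: x; apply: top_ext => [||t].
- by apply: linear_comp; [exact: top_map_linear | exact: (@Defs.act_linear _ (tree_operad M))].
- by apply: linear_comp (top_map_linear (n:=n)); exact: (@Defs.act_linear _ (tree_operad N)).
rewrite top_mapE /= !tactE top_mapE; apply: tgen_eq => /=.
exact: tree_map_tsubst.
Qed.

Lemma top_map_unit : top_map (unit (tree_operad M)) = unit (tree_operad N).
Proof. by rewrite /= /tunit top_mapE; exact: tgen_eq. Qed.

Lemma top_map_circ m n p (e : p.+1 = (m + n)%N) (i : 'I_m)
    (x : tree_operad M m) (y : tree_operad M n) :
  top_map (circ _ e i x y) = circ _ e i (top_map x) (top_map y).
Proof.
have [bl br] := circ_bilinear (tree_operad M) e i.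
have [bl' br'] := circ_bilinear (tree_operad N) e i.
move: x; apply: top_ext => [||t].
- by apply: linear_comp (bl y); exact: top_map_linear.
- by apply: linear_comp (bl' _) _; exact: top_map_linear.
move: y; apply: top_ext => [||s].
- by apply: linear_comp (br _); exact: top_map_linear.
- by apply: linear_comp (br' _) _; exact: top_map_linear.
rewrite !top_mapE /= !tcircE top_mapE; apply: tgen_eq; rewrite /= /graft tree_map_tsubst.
apply: eq_in_tsubst => j _; rewrite /graft_at; case: eqP => // _.
exact: tree_map_tsubst.
Qed.

Definition preim_ideal (J : operad_ideal (tree_operad N)) : operad_ideal (tree_operad M).
Proof.
apply: (@OperadIdeal _ _ (fun n => preim_submod (@top_map_linear n) (J n))) => /=.
- by move=> n x s Jx; rewrite [top_map _]top_map_act; exact: ideal_act.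
- by move=> m n p e i x y Jx; rewrite [top_map _]top_map_circ; exact: ideal_circl.
- by move=> m n p e i x y Jy; rewrite [top_map _]top_map_circ; exact: ideal_circr.
Defined.

(** [top_map] is a morphism of operads, so the preimage of the ideal generated by [H] is an ideal;
    it contains [G], hence also the ideal generated by [G]. *)
Lemma top_map_ideal_gen k (G : tree_operad M k -> Prop) (H : tree_operad N k -> Prop) :
  (forall g, G g -> H (top_map g)) ->
  forall n x, ideal_gen G n x -> ideal_gen H n (top_map x).
Proof.
move=> GH n x /(_ (preim_ideal (ideal_gen H))); apply => g /GH Hg J; exact.
Qed.

End FreeOperadMap.

Lemma top_mapK (K : fieldType) (M N : s2mod K) (f : M -> N) (g : N -> M) :
  linear f -> (forall x, f (s2flip x) = s2flip (f x)) ->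
  linear g -> (forall x, g (s2flip x) = s2flip (g x)) ->
  cancel f g -> forall n, cancel (@top_map K M N f n) (@top_map K N M g n).
Proof.
move=> lf ff lg fg fK n; apply: top_ext => [||t].
- by apply: linear_comp; exact: top_map_linear.
- by [].
rewrite !top_mapE //; apply: tgen_eq => /=.
by elim: (val t) => //= x l -> r ->; rewrite fK.
Qed.

(** * Isomorphisms of presented operads induced by isomorphisms of generators *)

Section QuadIso.
Variables (K : fieldType) (P Q : quad_data K).
Variables (f : qmod P -> qmod Q) (g : qmod Q -> qmod P).
Hypotheses (f_linear : linear f) (f_flip : forall x, f (s2flip x) = s2flip (f x)).
Hypotheses (fK : cancel f g) (gK : cancel g f).

Lemma cancel_flip x : g (s2flip x) = s2flip (g x).
Proof. by rewrite -{1}(gK x) -f_flip fK. Qed.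

Let g_linear : linear g := linear_cancel f_linear fK gK.

Hypothesis f_rel : forall r, qrel P r -> qrel Q (top_map f r).
Hypothesis g_rel : forall r, qrel Q r -> qrel P (top_map g r).

(** By functoriality [f] and [g] induce mutually inverse morphisms of free operads. Each carries the
    ideal of relators into the other, so both descend to the quotients. *)
Lemma quad_operad_iso : operad_iso (quad_operad P) (quad_operad Q).
Proof.
have fI := top_map_ideal_gen f_linear f_flip f_rel.
have gI := top_map_ideal_gen g_linear cancel_flip g_rel.
have fgK := top_mapK f_linear f_flip g_linear cancel_flip fK.
have gfK := top_mapK g_linear cancel_flip f_linear f_flip gK.
have fl n := @top_map_linear K _ _ f f_linear f_flip n.
have gl n := @top_map_linear K _ _ g g_linear cancel_flip n.
pose F n (q : quad_operad P n) : quad_operad Q n :=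
  qpi (ideal_gen (qrel Q) n) (top_map f (qrep q)).
pose G n (q : quad_operad Q n) : quad_operad P n :=
  qpi (ideal_gen (qrel P) n) (top_map g (qrep q)).
(* [F] and [G] are computed on canonical representatives; preservation of the ideals shows that any
   representative gives the same class. *)
have FE n x : F n (qpi _ x) = qpi _ (top_map f x).
  by apply/qpi_eq; rewrite -(linear_map_sub _ _ (fl n)); apply: fI; exact: qrep_qpi.
have GE n x : G n (qpi _ x) = qpi _ (top_map g x).
  by apply/qpi_eq; rewrite -(linear_map_sub _ _ (gl n)); apply: gI; exact: qrep_qpi.
exists F; split.
- move=> n; split; first move=> a.
    elim/qop_ind=> x; elim/qop_ind=> y.
    by rewrite -qpi_linear !FE fl qpi_linear.
  exists (G n); elim/qop_ind=> x.
    by rewrite FE GE fgK.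
  by rewrite GE FE gfK.
- by move=> n; elim/qop_ind=> x s; rewrite /= Defs.qactE !FE Defs.qactE top_map_act.
- by rewrite /= FE [top_map _ _]top_map_unit.
- move=> m n p e i; elim/qop_ind=> x; elim/qop_ind=> y.
  by rewrite /= qcircE !FE qcircE [top_map _ _]top_map_circ.
Qed.

End QuadIso.

(** * Levels on combs, and decomposition of the generators by level *)

Section LevelComb.
Variables (K : fieldType) (I : finType) (M : s2mod K) (mu nu : I).

(** The levels appear swapped because [level] names the level of the root first, whereas [comb]
    takes the upper decoration first. *)
Lemma level_comb c (x y : M) : level mu nu (comb c x y) = comb c (s2inj nu x) (s2inj mu y).
Proof. by rewrite /comb levelE; exact: tgen_eq. Qed.

Lemma s2sum_decomp (h : s2sum I M) : h = \sum_i s2inj i (h i).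
Proof.
apply/ffunP => j; rewrite sum_ffunE (bigD1 j) //= big1 => [|i ij]; rewrite !ffunE ?eqxx ?addr0 //.
by rewrite eq_sym (negPf ij).
Qed.

End LevelComb.

(** * The isomorphism between K^Omega (x) M and M^Omega *)

Section ScalarTensor.
Variables (K : fieldType) (I : finType) (M : s2mod K).

Definition scal_ffun (a : {ffun I -> K^o}) (x : M) : s2sum I M := [ffun i => (a i : K) *: x].

Lemma scal_ffun_bilinear : bilinear_map scal_ffun.
Proof.
split=> [x b a a'|a b x x']; apply/ffunP => i; rewrite !ffunE.
  by rewrite scalerDl scalerA.
by rewrite scalerDr !scalerA mulrC.
Qed.

(** The generators of Lie and Com share the carrier [K^o], so this one linear map serves both
    products; only the equivariance is checked twice. *)
Definition tens_to_sum : tensor {ffun I -> K^o} M -> s2sum I M := tens_lift scal_ffun.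

Definition delta_ffun (i : I) : {ffun I -> K^o} := s2inj i (1 : s2triv K).

Definition sum_to_tens (h : s2sum I M) : tensor {ffun I -> K^o} M :=
  \sum_i tens (delta_ffun i) (h i).

Lemma tens_to_sum_linear : linear tens_to_sum.
Proof. exact/tens_lift_linear/scal_ffun_bilinear. Qed.

Lemma tens_to_sumE a x : tens_to_sum (tens a x) = scal_ffun a x.
Proof. exact: tens_liftE scal_ffun_bilinear a x. Qed.

Lemma tens_to_sum_delta i x : tens_to_sum (tens (delta_ffun i) x) = s2inj i x.
Proof.
rewrite tens_to_sumE; apply/ffunP => j; rewrite !ffunE.
by case: eqP => _; rewrite ?scale1r ?scale0r.
Qed.

Lemma sum_to_tensK : cancel sum_to_tens tens_to_sum.
Proof.
move=> h; rewrite /sum_to_tens (linear_map_sum _ _ _ tens_to_sum_linear) {2}(s2sum_decomp h).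
by apply: eq_bigr => i _; rewrite tens_to_sum_delta.
Qed.

Lemma sum_to_tens_linear : linear sum_to_tens.
Proof.
apply: linear_bigsum => i a x y; rewrite !ffunE.
exact: (tens_bilinear _ _).2.
Qed.

Lemma tens_to_sumK : cancel tens_to_sum sum_to_tens.
Proof.
apply: tensor_ext => [||a x].
- by apply: linear_comp; [exact: sum_to_tens_linear | exact: tens_to_sum_linear].
- by [].
have [tl tr] := tens_bilinear {ffun I -> K^o} M.
rewrite tens_to_sumE /sum_to_tens.
rewrite [in RHS](s2sum_decomp (a : s2sum I (s2triv K))).
rewrite (linear_map_sum _ _ _ (tl x)); apply: eq_bigr => i _.
rewrite ffunE (linear_Z _ _ (tr _)) -(linear_Z _ _ (tl _)); congr (tens _ x).
by apply/ffunP => j; rewrite !ffunE; case: eqP => _; rewrite ?scaler0 // [LHS]mulr1.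
Qed.

Lemma tens_to_sum_flip_triv (w : s2tensor (s2sum I (s2triv K)) M) :
  tens_to_sum (s2flip w) = s2flip (tens_to_sum w).
Proof.
move: w; apply: tensor_ext => [||a x].
- exact: linear_comp tens_to_sum_linear (@s2flip_linear K (s2tensor (s2sum I (s2triv K)) M)).
- exact: linear_comp (@s2flip_linear K (s2sum I M)) tens_to_sum_linear.
rewrite /= tens_flipE !tens_to_sumE; apply/ffunP => i; rewrite !ffunE.
by rewrite (linear_Z _ _ (@s2flip_linear K M)).
Qed.

Lemma tens_to_sum_flip_sgn (w : s2twist (s2tensor (s2sum I (s2sgn K)) M)) :
  tens_to_sum (s2flip w) = s2flip (tens_to_sum w).
Proof.
move: w; apply: tensor_ext => [||a x].
- exact: linear_comp tens_to_sum_linear (@s2flip_linear K (s2twist (s2tensor (s2sum I (s2sgn K)) M))).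
- exact: linear_comp (@s2flip_linear K (s2sum I M)) tens_to_sum_linear.
(* The factor -1 extracted here comes from [s2twist]; the one that cancels it comes from the flip of
   [a] in [s2sgn]. *)
rewrite /= tens_flipE -scaleN1r (linear_Z _ _ tens_to_sum_linear) !tens_to_sumE.
apply/ffunP => i; rewrite !ffunE scalerA /= mulN1r opprK.
by rewrite (linear_Z _ _ (@s2flip_linear K M)).
Qed.

End ScalarTensor.

(** * The black product with the leveled Lie operad *)

Section BlackProduct.
Variables (K : fieldType) (I : finType) (P : quad_data K).

Let L := lmt I (Lie K).
Let phi : qmod (black L P) -> qmod (lmt I P) := @tens_to_sum K I (qmod P).
Let phi_linear : linear phi := @tens_to_sum_linear K I (qmod P).
Let phi_flip : forall w, phi (s2flip w) = s2flip (phi w) := @tens_to_sum_flip_sgn K I (qmod P).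

Definition jacobi : tree_operad (s2sgn K) 3 := \sum_c @comb K (s2sgn K) c 1 1.

Lemma top_map_black mu nu (v : tree_operad (qmod P) 3) :
  top_map phi (black_map (tens (level mu nu jacobi : tree_operad (qmod L) 3) v)) = level mu nu v.
Proof.
rewrite /black_map (tens_liftE (black_pair_bilinear _ _)) /black_pair.
rewrite (linear_map_sum _ _ _ (top_map_linear phi_linear phi_flip (n:=3))).
have -> : level mu nu v = \sum_c level mu nu (comb_lin c (comb_coord c v)).
  by rewrite {1}(comb_span v) (linear_map_sum _ _ _ (@level_linear _ _ _ _ _ 3)).
apply: eq_bigr => c _.
(* Each comb occurs in the Jacobi relator with coefficient 1, so this coordinate is the same for
   every [c] and every component of [v] survives. *)
have -> : comb_coord c (level mu nu jacobi) = tens (delta_ffun K nu) (delta_ffun K mu).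
  rewrite /jacobi (linear_map_sum _ _ _ (@level_linear _ _ _ _ _ 3)).
  rewrite (linear_map_sum _ _ _ (@comb_coord_linear _ _ _)) (bigD1 c) //= big1 => [|d dc].
    by rewrite level_comb comb_coordE eqxx addr0.
  by rewrite level_comb comb_coordE (negPf dc).
move: (comb_coord c v); apply: tensor_ext => [||x y].
- exact: linear_comp (top_map_linear phi_linear phi_flip (n:=3))
    (linear_comp (@comb_lin_linear K (qmod (black L P)) c)
      (linear_comp (@tens_mid_linear _ _ _ _ _) ((tens_bilinear _ _).2 _))).
- exact: linear_comp (@level_linear _ _ (qmod P) mu nu 3) (@comb_lin_linear _ _ c).
rewrite tens_midE !comb_linE top_map_comb // level_comb.
by rewrite /phi !tens_to_sum_delta.
Qed.

Lemma black_lie_lmt_iso : operad_iso (quad_operad (black L P)) (quad_operad (lmt I P)).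
Proof.
have phiK : cancel phi (@sum_to_tens K I (qmod P)) := @tens_to_sumK K I (qmod P).
have psiK : cancel (@sum_to_tens K I (qmod P)) phi := @sum_to_tensK K I (qmod P).
have tl := top_map_linear phi_linear phi_flip (n:=3).
have psi_flip := cancel_flip phi_flip phiK psiK.
have psi_linear := linear_cancel phi_linear phiK psiK.
apply: (@quad_operad_iso K (black L P) (lmt I P) phi (@sum_to_tens K I (qmod P))) => //.
(* The nested spans are peeled off in turn: relators of the black product, tensors of relators,
   leveled relators of Lie, and finally multiples of the Jacobi relator. *)
- apply: span_preim => // _ [w + ->].
  apply: (span_preim (f := fun w => top_map phi (black_map w))).
    by apply: linear_comp tl _; exact: black_map_linear.
  move=> _ [u [v [Lu Pv ->]]]; move: u Lu.
  have lu := linear_comp tl (linear_comp (@black_map_linear _ _ _) ((tens_bilinear _ _).1 v)).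
  apply: (span_preim lu) => _ [mu [nu [r [Jr ->]]]]; move: r Jr.
  apply: (span_preim (linear_comp lu (@level_linear _ _ _ mu nu 3))) => _ ->.
  by rewrite [top_map _ _]top_map_black; apply: span_gen; exists mu, nu, v.
- apply: span_preim; first exact: top_map_linear.
  (* A leveled relator is the image under [phi] of a black product with the Jacobi relator, so the
     inverse map returns that product. *)
  move=> _ [mu [nu [r [Pr ->]]]]; rewrite -top_map_black.
  rewrite (top_mapK phi_linear phi_flip psi_linear psi_flip phiK).
  apply: span_gen; exists (tens (level mu nu jacobi : tree_operad (qmod L) 3) r) => //.
  apply: span_gen; exists (level mu nu jacobi), r; split=> //.
  by apply: span_gen; exists mu, nu, jacobi; split=> //; exact: span_gen.
Qed.

End BlackProduct.

(** * The white product with the leveled Com operad *)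

Section WhiteProduct.
Variables (K : fieldType) (I : finType) (P : quad_data K).

Let C := lmt I (Com K).
Let phi : qmod (white C P) -> qmod (lmt I P) := @tens_to_sum K I (qmod P).
Let phi_linear : linear phi := @tens_to_sum_linear K I (qmod P).
Let phi_flip : forall w, phi (s2flip w) = s2flip (phi w) := @tens_to_sum_flip_triv K I (qmod P).

Section Coefficient.
Variables mu nu : I.

(** Here [a] decorates the upper vertex, of level [nu], and [b] the root, of level [mu]. *)
Definition eval_pair (a b : {ffun I -> K^o}) : K^o := a nu * b mu.

Lemma eval_pair_bilinear : bilinear_map eval_pair.
Proof.
split=> [b t x y|a t x y]; rewrite /eval_pair !ffunE.
  by rewrite mulrDl -mulrA.
by rewrite mulrDr mulrCA.
Qed.

(* Com^LMT(3) has one basis vector for each pair of levels (root mu, upper vertex nu);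
   com_coef is the corresponding coordinate. *)
Definition com_coef (u : tree_operad (qmod C) 3) : K^o :=
  \sum_c tens_lift eval_pair (comb_coord c u).

Lemma com_coef_linear : linear com_coef.
Proof.
apply: linear_bigsum => c.
apply: linear_comp (@comb_coord_linear _ _ _).
exact/tens_lift_linear/eval_pair_bilinear.
Qed.

Lemma com_coef_comb c a b : com_coef (comb c a b) = a nu * b mu.
Proof.
have l := tens_lift_linear eval_pair_bilinear.
rewrite /com_coef (bigD1 c) //= big1 => [|d dc]; rewrite comb_coordE.
  by rewrite eqxx addr0 (tens_liftE eval_pair_bilinear).
by rewrite eq_sym (negPf dc) (linear_0 l).
Qed.

(** The coefficient of a comb does not depend on its shape [c], and the relators are spanned by
    differences of two combs with equal decorations. *)
Lemma com_coef_rel u : qrel C u -> com_coef u = 0.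
Proof.
pose S := preim_submod com_coef_linear (Submod (in_submod := fun x => x = 0) erefl
  (fun a x y (hx : x = 0) (hy : y = 0) =>
     etrans (congr2 (fun u v => a *: u + v) hx hy) (etrans (addr0 _) (scaler0 _ _)))).
apply: (_ : forall u, _ -> S u) => {}u h; apply: h => _ [mu' [nu' [r [Cr ->]]]].
apply: (span_preim (@level_linear _ _ _ _ _ 3) _ Cr) => _ [c [c' ->]].
rewrite /= (linear_map_sub _ _ (@level_linear _ _ (s2triv K) mu' nu' 3)).
by rewrite (linear_map_sub _ _ com_coef_linear) !level_comb !com_coef_comb subrr.
Qed.

(** Its lift to the tensor product contracts the first factor with the functional
    [com_coef mu nu]. *)
Definition scale_coef (u : tree_operad (qmod C) 3) (v : tree_operad (qmod P) 3) :=
  (com_coef u : K) *: v.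

Lemma scale_coef_bilinear : bilinear_map scale_coef.
Proof.
split=> [v a x y|u a x y]; rewrite /scale_coef.
  by rewrite com_coef_linear scalerDl scalerA.
by rewrite scalerDr !scalerA mulrC.
Qed.

End Coefficient.

(** By linearity [z] may be a comb with a (x) x above and b (x) y at the root. Its component at
    levels [mu], [nu] is then a(nu) b(mu) times the comb of x and y, which is what the contraction
    of [Phi z] gives. *)
Lemma top_map_white (z : tree_operad (qmod (white C P)) 3) :
  top_map phi z = \sum_mu \sum_nu level mu nu (tens_lift (scale_coef mu nu) (Phi z)).
Proof.
have tl := top_map_linear phi_linear phi_flip (n:=3).
have sl mu nu := tens_lift_linear (scale_coef_bilinear mu nu).
have rl : linear (fun z => \sum_mu \sum_nu level mu nu (tens_lift (scale_coef mu nu) (Phi z))).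
  apply: linear_bigsum => mu; apply: linear_bigsum => nu.
  by apply: linear_comp (@level_linear _ _ _ _ _ 3) (linear_comp (sl _ _) (@Phi_linear _ _ _)).
rewrite (comb_span z) (linear_map_sum _ _ _ tl) (linear_map_sum _ _ _ rl).
apply: eq_bigr => c _; move: (comb_coord c z).
apply: tensor_ext => [||p q].
- by apply: linear_comp tl (@comb_lin_linear _ _ _).
- by apply: linear_comp rl (@comb_lin_linear _ _ _).
rewrite comb_linE; have [cl cr] := comb_bilinear (qmod (white C P)) c.
move: p; apply: tensor_ext => [||a x].
- exact: linear_comp tl (cl q).
- exact: linear_comp rl (cl q).
move: q; apply: tensor_ext => [||b y].
- exact: linear_comp tl (cr _).
- exact: linear_comp rl (cr _).
have [cl' cr'] := comb_bilinear (s2sum I (qmod P)) c.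
rewrite top_map_comb // PhiE /phi !tens_to_sumE.
rewrite [X in comb c _ X]s2sum_decomp (linear_map_sum _ _ _ (cr' _)).
apply: eq_bigr => mu _.
rewrite [X in comb c X _]s2sum_decomp (linear_map_sum _ _ _ (cl' _)).
apply: eq_bigr => nu _.
rewrite (tens_liftE (scale_coef_bilinear _ _)) /scale_coef com_coef_comb.
rewrite (linear_Z _ _ (@level_linear _ _ _ _ _ 3)) level_comb !ffunE.
rewrite !(linear_Z _ _ (@s2inj_linear _ _ _ _)) (linear_Z _ _ (cl' _)) (linear_Z _ _ (cr' _)).
by rewrite scalerA.
Qed.

Definition com_level (mu nu : I) (c : 'I_3) : tree_operad (qmod C) 3 :=
  @comb K (qmod C) c (delta_ffun K nu) (delta_ffun K mu).

Lemma com_level_rel mu nu c c' : qrel C (com_level mu nu c - com_level mu nu c').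
Proof.
apply: span_gen; exists mu, nu, (@comb K (s2triv K) c 1 1 - @comb K (s2triv K) c' 1 1); split.
  by apply: span_gen; exists c, c'.
by rewrite (linear_map_sub _ _ (@level_linear _ _ (s2triv K) mu nu 3)) !level_comb.
Qed.

(** The map [psi] turns the copy of u at level i into delta_i (x) u, so [Phi] separates the levels
    of each comb of [v] from its decorations. *)
Lemma Phi_level (psi := @sum_to_tens K I (qmod P)) mu nu (v : tree_operad (qmod P) 3) :
  Phi (top_map (psi : qmod (lmt I P) -> qmod (white C P)) (level mu nu v)) =
  \sum_c tens (com_level mu nu c) (comb_lin c (comb_coord c v)).
Proof.
have phiK : cancel phi psi := @tens_to_sumK K I (qmod P).
have psiK : cancel psi phi := @sum_to_tensK K I (qmod P).
have psi_flip := cancel_flip phi_flip phiK psiK.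
have psi_linear := linear_cancel phi_linear phiK psiK.
have ll := linear_comp (@Phi_linear _ _ _)
  (linear_comp (top_map_linear psi_linear psi_flip (n:=3)) (@level_linear _ _ _ mu nu 3)).
rewrite {1}(comb_span v) (linear_map_sum _ _ _ ll).
apply: eq_bigr => c _; move: (comb_coord c v); apply: tensor_ext => [||x y].
- exact: linear_comp ll (@comb_lin_linear _ _ _).
- exact: linear_comp ((tens_bilinear _ _).2 (com_level mu nu c)) (@comb_lin_linear K (qmod P) c).
rewrite comb_linE level_comb top_map_comb //.
have psi_inj i u : psi (s2inj i u) = tens (delta_ffun K i) u by rewrite -tens_to_sum_delta phiK.
by rewrite !psi_inj PhiE.
Qed.

Lemma lmt_white_com_iso : operad_iso (quad_operad (lmt I P)) (quad_operad (white C P)).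
Proof.
pose psi : qmod (lmt I P) -> qmod (white C P) := @sum_to_tens K I (qmod P).
have phiK : cancel phi psi := @tens_to_sumK K I (qmod P).
have psiK : cancel psi phi := @sum_to_tensK K I (qmod P).
have psi_flip := cancel_flip phi_flip phiK psiK.
have psi_linear := linear_cancel phi_linear phiK psiK.
apply: (@quad_operad_iso K (lmt I P) (white C P) psi phi) => //.
- apply: span_preim; first exact: top_map_linear.
  move=> _ [mu [nu [r [Pr ->]]]]; apply: span_gen.
  pose w c := comb_lin c (comb_coord c r).
  (* In the formula of [Phi_level], every comb of Com is replaced by the one of shape [ord0], an
     arbitrary choice. The errors are relators of Com, and the remaining terms add up to a tensor
     with [r]. *)
  exists (\sum_c tens (com_level mu nu c - com_level mu nu ord0) (w c)).
  exists (tens (com_level mu nu ord0) r); split.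
  + apply: submod_sum => c; apply: span_gen.
    exists (com_level mu nu c - com_level mu nu ord0), (w c); split=> //.
      exact: com_level_rel.
    exact: span_gen.
  + by apply: span_gen; exists (com_level mu nu ord0), r; split=> //; exact: span_gen.
  have [tl tr] := tens_bilinear (tree_operad (qmod C) 3) (tree_operad (qmod P) 3).
  rewrite Phi_level [X in tens _ X](comb_span r) (linear_map_sum _ _ _ (tr _)) -big_split.
  by apply: eq_bigr => c _; rewrite -[RHS](linear_D (tl (w c))) subrK.
- apply: span_preim; first exact: top_map_linear.
  move=> z [u [v [Ru Sv Ez]]]; rewrite top_map_white Ez.
  apply: submod_sum => mu; apply: submod_sum => nu.
  have sl := tens_lift_linear (scale_coef_bilinear mu nu).
  (* The relator of [P] is the contraction of [u + v]: that of [u] vanishes by [com_coef_rel], and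
     that of [v] is a combination of relators of [P]. *)
  apply: span_gen; exists mu, nu; eexists; split; last by [].
  rewrite (linear_D sl); apply: submodD.
  + apply: (span_preim sl _ Ru) => _ [r [t [Cr _ ->]]].
    rewrite (tens_liftE (scale_coef_bilinear _ _)) /scale_coef com_coef_rel // scale0r.
    exact: submod0.
  + apply: (span_preim sl _ Sv) => _ [t [r [_ Pr ->]]].
    rewrite (tens_liftE (scale_coef_bilinear _ _)); exact: submodZ.
Qed.

End WhiteProduct.

Theorem proposition3p7 (K : fieldType) (charK0 : [pchar K] =i pred0)
    (Omega : finType) (Omega_nonempty : (0 < #|Omega|)%N)
    (P : quad_data K) (Pfg : finitely_generated P) :
  operad_iso (quad_operad (black (lmt Omega (Lie K)) P)) (quad_operad (lmt Omega P)) /\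
  operad_iso (quad_operad (lmt Omega P)) (quad_operad (white (lmt Omega (Com K)) P)).
Proof. by split; [exact: black_lie_lmt_iso | exact: lmt_white_com_iso]. Qed.
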